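(* For $k=1,2,\dots$, let $D(2\pi k)$ denote the flat disk of circumference $2\pi k$ in $\mathbf R^2$ (centered at the origin), and let $\mathcal C_k=\mathbf Z_k\backslash D(2\pi k)$ be the cone, where the action of $\mathbf Z_k$ on $D(2\pi k)$ is generated by rotation through angle $\frac{2\pi}{k}$ about the origin. Then the disk $D(2\pi)$ and the cone $\mathcal C_k$ give rise to the same Dirichlet-to-Neumann operator on the circle: $$\mathcal D_{D(2\pi)}=\mathcal D_{\mathcal C_k}\quad\text{for every }k=1,2,\dots.$$
   Context: $\mathcal C_k$ is a Riemannian orbifold with the induced flat metric; smooth functions on $\mathcal C_k$ are those that pull back to smooth ($\mathbf Z_k$-invariant) functions on $D(2\pi k)$, and harmonicity and the outward normal derivative $\partial_\nu$ are computed on $D(2\pi k)$. Its boundary $\partial\mathcal C_k=\mathbf Z_k\backslash\partial D(2\pi k)$ is a smooth circle of length $2\pi$. For a compact Riemannian orbifold $\mathcal O$ with boundary, the Dirichlet-to-Neumann operator $\mathcal D_{\mathcal O}:C^\infty(\partial\mathcal O)\to C^\infty(\partial\mathcal O)$ sends $u$ to $\partial_\nu(Hu)$, where $Hu$ is the unique harmonic extension of $u$ to $\mathcal O$. The boundaries of $D(2\pi)$ and $\mathcal C_k$ are both identified with the circle of length $2\pi$ via the arclength coordinate. *)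

(* Defs.v *)
From Stdlib Require Import Reals ClassicalEpsilon.
From Coquelicot Require Import Coquelicot.

Open Scope R_scope.

Definition radius (L : R) : R := L / (2 * PI).

(* The closed flat disk of circumference [L] centred at the origin. *)
Definition disk (L : R) : Type :=
  { p : R * R | fst p ^ 2 + snd p ^ 2 <= radius L ^ 2 }.

Definition boundary_pair (L s : R) : R * R :=
  (radius L * cos (s / radius L), radius L * sin (s / radius L)).

Lemma boundary_pair_in_disk (L s : R) :
  fst (boundary_pair L s) ^ 2 + snd (boundary_pair L s) ^ 2 <= radius L ^ 2.
Proof.
  simpl fst; simpl snd; apply Req_le.
  generalize (sin2_cos2 (s / radius L)); unfold Rsqr; intros H.
  transitivity (radius L ^ 2 * (sin (s / radius L) * sin (s / radius L)
                                + cos (s / radius L) * cos (s / radius L))).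
  - ring.
  - rewrite H; ring.
Qed.

(* Arclength parametrisation of the boundary circle, counterclockwise from
   the positive x-axis. *)
Definition boundary_pt (L s : R) : disk L :=
  exist _ (boundary_pair L s) (boundary_pair_in_disk L s).

Definition rot (a : R) (p : R * R) : R * R :=
  (cos a * fst p - sin a * snd p, sin a * fst p + cos a * snd p).

(* A quotient of the flat disk of circumference [circ]; functions and their
   derivatives on it are computed upstairs, through [proj]. *)
Record disk_quotient : Type := DiskQuotient {
  circ : R;
  point : Type;
  proj : disk circ -> point
}.

Definition flat_disk (L : R) : disk_quotient :=
  DiskQuotient L (disk L) (fun z => z).

(* The orbit of [z] under the group generated by the rotation of angle
   [2 * PI / k]. *)
Definition orbit (k : nat) (L : R) (z : disk L) : disk L -> Prop :=
  fun z' => exists j : Z,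
    proj1_sig z' = rot (IZR j * (2 * PI / INR k)) (proj1_sig z).

Definition orbit_space (k : nat) (L : R) : Type :=
  { A : disk L -> Prop | exists z, A = orbit k L z }.

Definition orbit_proj (k : nat) (L : R) (z : disk L) : orbit_space k L :=
  exist _ (orbit k L z) (ex_intro _ z eq_refl).

Definition cone (k : nat) : disk_quotient :=
  DiskQuotient (2 * PI * INR k) (orbit_space k (2 * PI * INR k))
    (orbit_proj k (2 * PI * INR k)).

Definition smooth2 (F : R -> R -> R) : Prop :=
  forall (n : nat) (x y : R), ex_diff_n F n x y.

(* A function on the closed disk is smooth up to the boundary when it is the
   restriction of a smooth function [F] on the plane.  The partial derivatives
   of [F] on the closed disk do not depend on the choice of [F]. *)
Definition smooth_lift (O : disk_quotient) (w : point O -> R)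
    (F : R -> R -> R) : Prop :=
  smooth2 F /\
  forall z : disk (circ O),
    w (proj O z) = F (fst (proj1_sig z)) (snd (proj1_sig z)).

Definition laplacian (F : R -> R -> R) (x y : R) : R :=
  partial_derive 2 0 F x y + partial_derive 0 2 F x y.

Definition smooth_harmonic (O : disk_quotient) (w : point O -> R) : Prop :=
  exists F, smooth_lift O w F /\
    forall x y, x ^ 2 + y ^ 2 < radius (circ O) ^ 2 -> laplacian F x y = 0.

(* [d] is the outward normal derivative of [w] at the boundary point of
   arclength coordinate [s]; the outward unit normal there is
   [(cos (s / r), sin (s / r))], with [r] the radius. *)
Definition is_normal_derivative (O : disk_quotient) (w : point O -> R)
    (s d : R) : Prop :=
  exists F, smooth_lift O w F /\
    is_derive (fun t => F ((radius (circ O) + t) * cos (s / radius (circ O)))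
                          ((radius (circ O) + t) * sin (s / radius (circ O))))
      0 d.

(* Smooth functions on the circle of length [2 * PI], in the arclength
   coordinate. *)
Record circle_fun : Type := CircleFun {
  cfun :> R -> R;
  cfun_periodic : forall s, cfun (s + 2 * PI) = cfun s;
  cfun_smooth : forall n s, ex_derive_n cfun n s
}.

Definition circle_zero : circle_fun :=
  CircleFun (fun _ => 0) (fun _ => eq_refl)
    (fun n s => ex_derive_n_const 0 n s).

Definition harmonic_extension (O : disk_quotient) (u : circle_fun)
    (w : point O -> R) : Prop :=
  smooth_harmonic O w /\
  forall s, w (proj O (boundary_pt (circ O) s)) = u s.

Definition DN_graph (O : disk_quotient) (u g : circle_fun) : Prop :=
  exists w, harmonic_extension O u w /\
    forall s, is_normal_derivative O w s (g s).

Definition DN_well_defined (O : disk_quotient) : Prop :=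
  forall u : circle_fun,
    (exists! w, harmonic_extension O u w) /\ (exists! g, DN_graph O u g).

(* The Dirichlet-to-Neumann operator; the zero function only serves to make it
   total, and is never used when [DN_well_defined O] holds. *)
Definition DN (O : disk_quotient) : circle_fun -> circle_fun :=
  fun u => epsilon (inhabits circle_zero) (DN_graph O u).

(* Main.v *)
(** Separation of variables.  Write [u(s) = sum_n a_n cos(ns) + b_n sin(ns)].
    Then [sum_n Re((a_n - i b_n) (z/k)^(kn))] is harmonic on the disk of radius [k]
    (circumference [2 PI k]), invariant under the rotation of angle [2 PI / k], and
    equal to [u(s)] at arclength [s]; its normal derivative there is
    [sum_n (kn/k) (a_n cos(ns) + b_n sin(ns))], in which [k] cancels.

    Since smoothness up to the boundary means having a smooth extension to the plane,
    the [n]-th mode is multiplied by a cutoff supported in the collar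
    [|z/k|^2 <= 1 + 1/(kn+1)].  There [(z/k)^(kn)] stays bounded, so that all derivatives
    of the modes grow at most polynomially in [n], while [a_n] and [b_n] decay rapidly. *)

(* The map z -> (z/k)^k from the disk of radius [k] to the unit disk pulls harmonic functions back
   to invariant harmonic functions and has radial derivative 1 at the boundary, which already
   explains the equality. But the claim includes that both operators are well defined, and this
   requires solving the Dirichlet problem for arbitrary smooth data with regularity up to the
   boundary; Fourier series supply that. The collar has to shrink with the frequency: on one of
   fixed width the modes would grow exponentially in [n], which coefficients known only to decay
   faster than every power need not compensate. The price is a factor of order kn + 1 for each
   derivative of the cutoff, which is still polynomial. [DN] is selected by [epsilon] from a
   relation, so computing it means showing that the relation has exactly one solution: the maximum
   principle makes the extension unique, and one-sided difference quotients make the normal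
   derivative independent of the lift. The disk is the case k = 1 of the argument for the cone. *)
Require Import Defs.
From Stdlib Require Import Reals ZArith Lra Lia Psatz.
From Stdlib Require Import FunctionalExtensionality ClassicalEpsilon ProofIrrelevance.
From Coquelicot Require Import Coquelicot.
Open Scope R_scope.

(** * Term-by-term differentiation of rapidly convergent series *)

(* Coquelicot's structures state equalities in types that are only convertible to [R],
   which [ring] and [field] do not see through. *)
Ltac as_Req := match goal with |- @eq _ ?a ?b => change (@eq R a b) end.

(* Stated as a chain rule along curves, so that closure under sums, products and
   composition reduces to the one-variable rules, and lines give both partial
   derivatives and the normal derivative. *)
Definition has_grad (f fx fy : R -> R -> R) : Prop :=
  forall (X Y : R -> R) (t dX dY : R),
    is_derive X t dX -> is_derive Y t dY ->
    is_derive (fun s => f (X s) (Y s)) t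
      (fx (X t) (Y t) * dX + fy (X t) (Y t) * dY).

Lemma has_grad_x (f fx fy : R -> R -> R) (x y : R) :
  has_grad f fx fy -> is_derive (fun t => f t y) x (fx x y).
Proof.
  intros H.
  generalize (H (fun t => t) (fun _ => y) x 1 0 (is_derive_id x) (is_derive_const y x)).
  simpl; now rewrite Rmult_1_r, Rmult_0_r, Rplus_0_r.
Qed.

Lemma has_grad_y (f fx fy : R -> R -> R) (x y : R) :
  has_grad f fx fy -> is_derive (fun t => f x t) y (fy x y).
Proof.
  intros H.
  generalize (H (fun _ => x) (fun t => t) y 0 1 (is_derive_const x y) (is_derive_id y)).
  simpl; now rewrite Rmult_1_r, Rmult_0_r, Rplus_0_l.
Qed.

Lemma is_derive_continuity (f : R -> R) (x l : R) :
  is_derive f x l -> continuity_pt f x.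
Proof.
  intros H; apply derivable_continuous_pt; exists l.
  now apply is_derive_Reals.
Qed.

Lemma quadratic_differentiable (f : R -> R -> R) (x y lx ly C : R) :
  (forall h k, Rabs (f (x + h) (y + k) - f x y - (lx * h + ly * k))
     <= C * (h ^ 2 + k ^ 2)) ->
  differentiable_pt_lim f x y lx ly.
Proof.
  intros H eps.
  assert (HC : 0 <= C).
  { generalize (H 1 0) (Rabs_pos (f (x + 1) (y + 0) - f x y - (lx * 1 + ly * 0))).
    lra. }
  (* With m the larger of |h| and |k|, the remainder is at most 2 C m^2, so 2 C m <= eps suffices;
     the extra 1 keeps the quotient meaningful when [C = 0]. *)
  assert (Hd : 0 < eps / (2 * C + 1)).
  { apply Rdiv_lt_0_compat; [apply cond_pos | lra]. }
  exists (mkposreal _ Hd); intros u v Hu Hv; simpl in Hu, Hv.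
  specialize (H (u - x) (v - y)).
  replace (x + (u - x)) with u in H by ring.
  replace (y + (v - y)) with v in H by ring.
  eapply Rle_trans; [exact H |].
  set (m := Rmax (Rabs (u - x)) (Rabs (v - y))).
  assert (Hm1 : Rabs (u - x) <= m) by apply Rmax_l.
  assert (Hm2 : Rabs (v - y) <= m) by apply Rmax_r.
  assert (Hm3 : m < eps / (2 * C + 1)) by now apply Rmax_lub_lt.
  assert (H0 : 0 <= m) by (generalize (Rabs_pos (u - x)); lra).
  rewrite <- (pow2_abs (u - x)), <- (pow2_abs (v - y)).
  assert (Rabs (u - x) ^ 2 <= m ^ 2) by (apply pow_incr; split; [apply Rabs_pos | easy]).
  assert (Rabs (v - y) ^ 2 <= m ^ 2) by (apply pow_incr; split; [apply Rabs_pos | easy]).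
  assert (Hm4 : (2 * C + 1) * m <= eps).
  { apply Rlt_le in Hm3. apply (Rmult_le_compat_l (2 * C + 1)) in Hm3; [| lra].
    field_simplify in Hm3; lra. }
  nra.
Qed.

Lemma differentiable_has_grad (f fx fy : R -> R -> R) :
  (forall x y, differentiable_pt_lim f x y (fx x y) (fy x y)) -> has_grad f fx fy.
Proof.
  intros H X Y t dX dY HX HY.
  apply is_derive_Reals.
  apply derivable_pt_lim_comp_2d; [apply H | |]; now apply is_derive_Reals.
Qed.

(** The mean value theorem is applied twice along the segment: the increment of [f] is [p1 c], and
    [p1 c - p1 0] is [c * p2 d], where [p2 d] is a quadratic form in (h, k) with coefficients
    bounded by [M]. *)
Lemma taylor_quadratic (f fx fy fxx fxy fyx fyy : R -> R -> R) (M : R) :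
  has_grad f fx fy -> has_grad fx fxx fxy -> has_grad fy fyx fyy ->
  (forall x y, Rabs (fxx x y) <= M) -> (forall x y, Rabs (fxy x y) <= M) ->
  (forall x y, Rabs (fyx x y) <= M) -> (forall x y, Rabs (fyy x y) <= M) ->
  forall x y h k,
    Rabs (f (x + h) (y + k) - f x y - (fx x y * h + fy x y * k))
      <= 2 * M * (h ^ 2 + k ^ 2).
Proof.
  intros H Hx Hy Bxx Bxy Byx Byy x y h k.
  set (X := fun t : R => x + t * h); set (Y := fun t : R => y + t * k).
  assert (DX : forall t, is_derive X t h) by (intros t; unfold X; auto_derive; [easy | ring]).
  assert (DY : forall t, is_derive Y t k) by (intros t; unfold Y; auto_derive; [easy | ring]).
  set (p1 := fun t => fx (X t) (Y t) * h + fy (X t) (Y t) * k).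
  assert (D0 : forall t, is_derive (fun s => f (X s) (Y s)) t (p1 t)).
  { intros t; now apply H. }
  set (p2 := fun t => (fxx (X t) (Y t) * h + fxy (X t) (Y t) * k) * h
                      + (fyx (X t) (Y t) * h + fyy (X t) (Y t) * k) * k).
  assert (D1 : forall t, is_derive p1 t (p2 t)).
  { intros t. unfold p1, p2.
    apply (is_derive_plus (fun t => fx (X t) (Y t) * h) (fun t => fy (X t) (Y t) * k)).
    - apply is_derive_ext with (fun t => h * fx (X t) (Y t)); [intros; as_Req; ring |].
      rewrite Rmult_comm; apply is_derive_scal; now apply Hx.
    - apply is_derive_ext with (fun t => k * fy (X t) (Y t)); [intros; as_Req; ring |].
      rewrite Rmult_comm; apply is_derive_scal; now apply Hy. }
  destruct (MVT_gen (fun s => f (X s) (Y s)) 0 1 p1) as [c [Hc Ec]].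
  { intros; apply D0. }
  { intros; eapply is_derive_continuity; apply D0. }
  destruct (MVT_gen p1 0 c p2) as [d [Hd Ed]].
  { intros; apply D1. }
  { intros; eapply is_derive_continuity; apply D1. }
  rewrite Rmin_left, Rmax_right in Hc by lra.
  assert (E : f (x + h) (y + k) - f x y - (fx x y * h + fy x y * k) = p2 d * c).
  { replace (fx x y * h + fy x y * k) with (p1 0)
      by (unfold p1, X, Y; now rewrite !Rmult_0_l, !Rplus_0_r).
    unfold X, Y in Ec. rewrite !Rmult_1_l, !Rmult_0_l, !Rplus_0_r in Ec. lra. }
  rewrite E, Rabs_mult, (Rabs_right c) by lra.
  assert (B2 : Rabs (p2 d) <= 2 * M * (h ^ 2 + k ^ 2)).
  { assert (0 <= M) by (generalize (Bxx x y) (Rabs_pos (fxx x y)); lra).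
    unfold p2.
    replace (_ + _) with (fxx (X d) (Y d) * (h * h) + fxy (X d) (Y d) * (h * k)
      + fyx (X d) (Y d) * (h * k) + fyy (X d) (Y d) * (k * k)) by ring.
    assert (A : forall u v, Rabs u <= M -> Rabs (u * v) <= M * Rabs v).
    { intros u v Hu. rewrite Rabs_mult. apply Rmult_le_compat_r; [apply Rabs_pos | easy]. }
    eapply Rle_trans; [apply Rabs_triang |].
    eapply Rle_trans; [apply Rplus_le_compat_r, Rabs_triang |].
    eapply Rle_trans; [apply Rplus_le_compat_r, Rplus_le_compat_r, Rabs_triang |].
    generalize (A _ (h * h) (Bxx (X d) (Y d))) (A _ (h * k) (Bxy (X d) (Y d)))
      (A _ (h * k) (Byx (X d) (Y d))) (A _ (k * k) (Byy (X d) (Y d))).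
    rewrite !Rabs_mult, <- (pow2_abs h), <- (pow2_abs k).
    intros.
    (* This is 2 |h| |k| <= h^2 + k^2, which absorbs the two mixed terms. *)
    assert (0 <= M * (Rabs h - Rabs k) ^ 2) by (apply Rmult_le_pos; [easy | apply pow2_ge_0]).
    nra. }
  generalize (Rabs_pos (p2 d)); nra.
Qed.

(** [ex_diff_n] recurses on the partial derivatives as functions, so membership in a class stable
    under partial derivatives is the invariant that carries the induction on the order. *)
Lemma smooth2_of_class (S : (R -> R -> R) -> Prop) :
  (forall f, S f -> (forall x y, continuity_2d_pt f x y) /\
     exists fx fy, S fx /\ S fy /\ has_grad f fx fy) ->
  forall f, S f -> smooth2 f.
Proof.
  intros HS f Hf n; revert f Hf; induction n as [| n IH]; intros f Hf x y;
    destruct (HS f Hf) as [Hc [fx [fy [Sx [Sy Hg]]]]].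
  - split; [apply Hc | exact I].
  - assert (Ex : (fun u v => Derive (fun z => f z v) u) = fx).
    { extensionality u; extensionality v.
      eapply is_derive_unique, has_grad_x, Hg. }
    assert (Ey : (fun u v => Derive (fun z => f u z) v) = fy).
    { extensionality u; extensionality v.
      eapply is_derive_unique, has_grad_y, Hg. }
    simpl; rewrite Ex, Ey.
    split; [apply Hc | split; [| split; [| split; now apply IH]]].
    + exists (fx x y); eapply has_grad_x, Hg.
    + exists (fy x y); eapply has_grad_y, Hg.
Qed.

Definition rapid (a : nat -> R) : Prop :=
  forall p : nat, exists C, forall n, Rabs (a n) * (INR n + 1) ^ p <= C.

Definition poly_bounded (H : nat -> R -> R -> R) : Prop :=
  exists C p, forall n x y, Rabs (H n x y) <= C * (INR n + 1) ^ p.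

(** The second clause can be iterated: partial derivatives of every order stay polynomially bounded
    in [n], uniformly over the plane, which is what rapidly decaying coefficients can absorb. *)
Definition tame_class (T : (nat -> R -> R -> R) -> Prop) : Prop :=
  (forall H, T H -> poly_bounded H) /\
  (forall H, T H -> exists Hx Hy, T Hx /\ T Hy /\
     forall n, has_grad (H n) (Hx n) (Hy n)).

Definition fsum (a : nat -> R) (H : nat -> R -> R -> R) (x y : R) : R :=
  Series (fun n => a n * H n x y).

Lemma INR_succ_ge_1 (n : nat) : 1 <= INR n + 1.
Proof. generalize (pos_INR n); lra. Qed.

Lemma ex_series_inv_sq : ex_series (fun n => / (INR n + 1) ^ 2).
Proof.
  apply ex_finite_lim_seq_incr with 2.
  - intros n. rewrite sum_Sn.
    change (sum_n (fun n => / (INR n + 1) ^ 2) n <= sum_n (fun n => / (INR n + 1) ^ 2) n + / (INR (S n) + 1) ^ 2).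
    rewrite <- (Rplus_0_r (sum_n _ _)) at 1.
    apply Rplus_le_compat_l, Rlt_le, Rinv_0_lt_compat, pow_lt.
    generalize (INR_succ_ge_1 (S n)); lra.
  (* Telescoping: 1/(m+1)^2 is below 1/m - 1/(m+1), and the gap is exactly 1/(m (m+1)^2). *)
  - assert (B : forall n, sum_n (fun n => / (INR n + 1) ^ 2) n <= 2 - / (INR n + 1)).
    { induction n as [| n IH].
      - rewrite sum_O; simpl; lra.
      - rewrite sum_Sn; unfold plus; simpl plus.
        eapply Rle_trans; [apply Rplus_le_compat_r, IH |].
        rewrite S_INR. generalize (INR_succ_ge_1 n); intros Hn.
        set (m := INR n + 1) in *.
        assert (E : / m - / (m + 1) - / (m + 1) ^ 2 = / (m * (m + 1) ^ 2)).
        { field; lra. }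
        assert (0 < / (m * (m + 1) ^ 2)).
        { apply Rinv_0_lt_compat. apply Rmult_lt_0_compat; [lra | apply pow_lt; lra]. }
        change (2 - / m + / (m + 1) ^ 2 <= 2 - / (m + 1)); lra. }
    intros n. eapply Rle_trans; [apply B |].
    assert (0 < / (INR n + 1)) by (apply Rinv_0_lt_compat; generalize (INR_succ_ge_1 n); lra).
    lra.
Qed.

Lemma rapid_majorant (a : nat -> R) (C : R) (p : nat) :
  rapid a -> exists M : nat -> R, ex_series M /\
    forall n u, Rabs u <= C * (INR n + 1) ^ p -> Rabs (a n) * Rabs u <= M n.
Proof.
  (* The two spare powers leave the summable factor 1/(n+1)^2. *)
  intros Ha; destruct (Ha (p + 2)%nat) as [D HD].
  exists (fun n => (Rabs C * D) * / (INR n + 1) ^ 2); split.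
  - apply (ex_series_scal (Rabs C * D) _ ex_series_inv_sq).
  - intros n u Hu. specialize (HD n).
    generalize (INR_succ_ge_1 n); intros Hn. set (m := INR n + 1) in *.
    assert (Hm : 0 < m ^ 2) by (apply pow_lt; lra).
    assert (Hp : 0 <= m ^ p) by (apply pow_le; lra).
    rewrite pow_add in HD.
    apply (Rmult_le_reg_r (m ^ 2)); [easy |].
    replace (Rabs C * D * / m ^ 2 * m ^ 2) with (Rabs C * D) by (field; lra).
    assert (Rabs u <= Rabs C * m ^ p).
    { eapply Rle_trans; [apply Hu |]. apply Rmult_le_compat_r; [easy | apply Rle_abs]. }
    apply Rle_trans with (Rabs C * (Rabs (a n) * (m ^ p * m ^ 2))).
    + replace (Rabs C * (Rabs (a n) * (m ^ p * m ^ 2)))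
        with (Rabs (a n) * (Rabs C * m ^ p) * m ^ 2) by ring.
      apply Rmult_le_compat_r; [lra |]. apply Rmult_le_compat_l; [apply Rabs_pos | easy].
    + apply Rmult_le_compat_l; [apply Rabs_pos | easy].
Qed.

Lemma ex_series_fsum (a : nat -> R) (H : nat -> R -> R -> R) (x y : R) :
  rapid a -> poly_bounded H -> ex_series (fun n => a n * H n x y).
Proof.
  intros Ha [C [p HH]]; destruct (rapid_majorant a C p Ha) as [M [HM B]].
  apply (ex_series_le (V := R_CompleteNormedModule)) with M; [| easy].
  intros n; unfold norm; simpl; unfold abs; simpl; rewrite Rabs_mult; now apply B.
Qed.

(* A Taylor remainder bounded uniformly in each term is summable, which replaces the
   theorems on uniform convergence of derivatives. *)
Lemma fsum_quadratic (T : (nat -> R -> R -> R) -> Prop) (a : nat -> R)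
    (H Hx Hy : nat -> R -> R -> R) :
  tame_class T -> rapid a -> T H -> T Hx -> T Hy ->
  (forall n, has_grad (H n) (Hx n) (Hy n)) ->
  exists C, forall x y h k,
    Rabs (fsum a H (x + h) (y + k) - fsum a H x y
          - (fsum a Hx x y * h + fsum a Hy x y * k)) <= C * (h ^ 2 + k ^ 2).
Proof.
  intros [TB TG] Ha TH THx THy HG.
  destruct (TG _ THx) as [Hxx [Hxy [Txx [Txy Gx]]]].
  destruct (TG _ THy) as [Hyx [Hyy [Tyx [Tyy Gy]]]].
  destruct (TB _ Txx) as [C1 [p1 B1]]. destruct (TB _ Txy) as [C2 [p2 B2]].
  destruct (TB _ Tyx) as [C3 [p3 B3]]. destruct (TB _ Tyy) as [C4 [p4 B4]].
  set (p := (p1 + p2 + p3 + p4)%nat).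
  set (C := Rabs C1 + Rabs C2 + Rabs C3 + Rabs C4).
  assert (BC : forall q D n u, (q <= p)%nat -> Rabs D <= C ->
            Rabs u <= D * (INR n + 1) ^ q -> Rabs u <= C * (INR n + 1) ^ p).
  { intros q D n u Hq HD Hu. eapply Rle_trans; [apply Hu |].
    apply Rle_trans with (Rabs D * (INR n + 1) ^ q).
    - apply Rmult_le_compat_r; [apply pow_le; generalize (INR_succ_ge_1 n); lra | apply Rle_abs].
    - apply Rmult_le_compat; [apply Rabs_pos | apply pow_le; generalize (INR_succ_ge_1 n); lra
        | easy | apply Rle_pow; [apply INR_succ_ge_1 | easy]]. }
  generalize (Rabs_pos C1) (Rabs_pos C2) (Rabs_pos C3) (Rabs_pos C4); intros.
  destruct (rapid_majorant a (2 * C) p Ha) as [M [HM BM]].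
  exists (Series M); intros x y h k.
  assert (Q : forall n, Rabs (a n * (H n (x + h) (y + k) - H n x y
             - (Hx n x y * h + Hy n x y * k))) <= M n * (h ^ 2 + k ^ 2)).
  { intros n. rewrite Rabs_mult.
    assert (L : 0 <= h ^ 2 + k ^ 2) by (generalize (pow2_ge_0 h) (pow2_ge_0 k); lra).
    apply Rle_trans with (Rabs (a n) * Rabs (2 * (C * (INR n + 1) ^ p)) * (h ^ 2 + k ^ 2)).
    - rewrite Rmult_assoc. apply Rmult_le_compat_l; [apply Rabs_pos |].
      rewrite (Rabs_right (2 * _)).
      + apply (taylor_quadratic (H n) (Hx n) (Hy n) (Hxx n) (Hxy n) (Hyx n) (Hyy n)
                 (C * (INR n + 1) ^ p)); try easy; intros u v.
        * apply (BC p1 C1); [unfold p; lia | unfold C; lra | easy].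
        * apply (BC p2 C2); [unfold p; lia | unfold C; lra | easy].
        * apply (BC p3 C3); [unfold p; lia | unfold C; lra | easy].
        * apply (BC p4 C4); [unfold p; lia | unfold C; lra | easy].
      + apply Rle_ge. assert (0 <= (INR n + 1) ^ p) by (apply pow_le; generalize (INR_succ_ge_1 n); lra).
        assert (0 <= C) by (unfold C; lra). nra.
    - apply Rmult_le_compat_r; [easy |]. apply BM.
      rewrite Rabs_right; [lra |].
      apply Rle_ge. assert (0 <= (INR n + 1) ^ p) by (apply pow_le; generalize (INR_succ_ge_1 n); lra).
      assert (0 <= C) by (unfold C; lra). nra. }
  assert (E : forall u v, ex_series (fun n => a n * H n u v))
    by (intros; apply ex_series_fsum; [easy | now apply TB]).
  assert (Ex : ex_series (fun n => h * (a n * Hx n x y)))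
    by (apply (ex_series_scal (V := R_NormedModule)), ex_series_fsum; [easy | now apply TB]).
  assert (Ey : ex_series (fun n => k * (a n * Hy n x y)))
    by (apply (ex_series_scal (V := R_NormedModule)), ex_series_fsum; [easy | now apply TB]).
  assert (Eq : fsum a H (x + h) (y + k) - fsum a H x y
          - (fsum a Hx x y * h + fsum a Hy x y * k)
      = Series (fun n => a n * (H n (x + h) (y + k) - H n x y
             - (Hx n x y * h + Hy n x y * k)))).
  { unfold fsum. rewrite (Rmult_comm _ h), (Rmult_comm _ k), <- !Series_scal_l.
    rewrite <- Series_plus by easy. rewrite <- Series_minus by easy.
    rewrite <- Series_minus.
    - apply Series_ext; intros n; ring.
    - now apply (ex_series_minus (V := R_NormedModule)).
    - now apply (ex_series_plus (V := R_NormedModule)). }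
  rewrite Eq. rewrite <- Series_scal_r.
  assert (EM : ex_series (fun n => M n * (h ^ 2 + k ^ 2))).
  { apply ex_series_ext with (fun n => (h ^ 2 + k ^ 2) * M n); [intros; as_Req; ring |].
    now apply (ex_series_scal (V := R_NormedModule)). }
  eapply Rle_trans; [apply Series_Rabs |].
  - apply (ex_series_le (V := R_CompleteNormedModule)) with (2 := EM).
    intros n; unfold norm; simpl; unfold abs; simpl; rewrite Rabs_Rabsolu. apply Q.
  - apply Series_le; [| easy]. intros n; split; [apply Rabs_pos | apply Q].
Qed.

Lemma fsum_differentiable (T : (nat -> R -> R -> R) -> Prop) (a : nat -> R)
    (H Hx Hy : nat -> R -> R -> R) :
  tame_class T -> rapid a -> T H -> T Hx -> T Hy ->
  (forall n, has_grad (H n) (Hx n) (Hy n)) ->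
  forall x y, differentiable_pt_lim (fsum a H) x y (fsum a Hx x y) (fsum a Hy x y).
Proof.
  intros HT Ha TH Tx Ty HG x y.
  destruct (fsum_quadratic T a H Hx Hy HT Ha TH Tx Ty HG) as [C HC].
  apply quadratic_differentiable with C; intros; apply HC.
Qed.

Lemma has_grad_plus (f fx fy g gx gy : R -> R -> R) :
  has_grad f fx fy -> has_grad g gx gy ->
  has_grad (fun x y => f x y + g x y) (fun x y => fx x y + gx x y)
    (fun x y => fy x y + gy x y).
Proof.
  intros Hf Hg X Y t dX dY HX HY.
  replace (_ + _) with ((fx (X t) (Y t) * dX + fy (X t) (Y t) * dY)
     + (gx (X t) (Y t) * dX + gy (X t) (Y t) * dY)) by ring.
  apply (is_derive_plus (fun s => f (X s) (Y s)) (fun s => g (X s) (Y s)));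
    [now apply Hf | now apply Hg].
Qed.

(** For fixed coefficients, sums of this shape over [T] are stable under partial derivatives because
    [T] is, so [smooth2_of_class] applies to them. *)
Lemma fsum_smooth2 (T : (nat -> R -> R -> R) -> Prop) (a b : nat -> R)
    (H K : nat -> R -> R -> R) :
  tame_class T -> rapid a -> rapid b -> T H -> T K ->
  smooth2 (fun x y => fsum a H x y + fsum b K x y).
Proof.
  intros HT Ha Hb TH TK.
  apply (smooth2_of_class (fun f => exists H K, T H /\ T K /\
           f = fun x y => fsum a H x y + fsum b K x y)); [| now exists H, K].
  clear H K TH TK. intros f [H [K [TH [TK Ef]]]].
  destruct (proj2 HT H TH) as [Hx [Hy [THx [THy GH]]]].
  destruct (proj2 HT K TK) as [Kx [Ky [TKx [TKy GK]]]].
  assert (DH := fsum_differentiable T a H Hx Hy HT Ha TH THx THy GH).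
  assert (DK := fsum_differentiable T b K Kx Ky HT Hb TK TKx TKy GK).
  subst f; split.
  - intros x y. apply continuity_2d_pt_plus; apply differentiable_continuity_pt;
      eexists; eexists; [apply DH | apply DK].
  - exists (fun x y => fsum a Hx x y + fsum b Kx x y),
      (fun x y => fsum a Hy x y + fsum b Ky x y).
    split; [now exists Hx, Kx | split; [now exists Hy, Ky |]].
    apply has_grad_plus; now apply differentiable_has_grad.
Qed.

(** * Flat functions, the cutoff, and powers of a complex variable *)

(** This is the [j]-th power of y/j <= exp (y/j). For [j = 0] the convention that 0 ^ 0 is 1 gives
    the right constant. *)
Lemma pow_le_exp (j : nat) (y : R) : 0 <= y -> y ^ j <= INR j ^ j * exp y.
Proof.
  intros Hy; destruct j as [| j].
  - simpl. generalize (exp_ineq1_le y); lra.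
  - assert (Hj : 0 < INR (S j)) by (apply lt_0_INR; lia).
    replace (exp y) with (exp (y / INR (S j)) ^ S j).
    + rewrite <- Rpow_mult_distr. apply pow_incr; split; [easy |].
      generalize (exp_ineq1_le (y / INR (S j))); intros H.
      apply Rle_trans with (INR (S j) * (y / INR (S j))); [right; field; lra |].
      apply Rmult_le_compat_l; lra.
    + rewrite <- Rpower_pow by apply exp_pos. unfold Rpower.
      rewrite ln_exp. f_equal. field; lra.
Qed.

(** The powers of [/ x] make the family closed under differentiation: every derivative of exp (-1/x)
    is a linear combination of its members. *)
Definition flat (j : nat) (x : R) : R :=
  if Rlt_dec 0 x then (/ x) ^ j * exp (- / x) else 0.

Lemma flat_pos_eq (j : nat) (x : R) : 0 < x -> flat j x = (/ x) ^ j * exp (- / x).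
Proof. intros H; unfold flat; now destruct (Rlt_dec 0 x). Qed.

Lemma flat_neg (j : nat) (x : R) : x <= 0 -> flat j x = 0.
Proof. intros H; unfold flat; destruct (Rlt_dec 0 x); [lra | easy]. Qed.

Lemma flat_bounds (j : nat) (x : R) : 0 <= flat j x <= INR j ^ j.
Proof.
  destruct (Rlt_dec 0 x) as [H | H].
  - rewrite flat_pos_eq by easy.
    assert (Hi : 0 < / x) by now apply Rinv_0_lt_compat.
    assert (B := pow_le_exp j (/ x) (Rlt_le _ _ Hi)).
    rewrite exp_Ropp. assert (He := exp_pos (/ x)).
    assert (0 < / exp (/ x)) by now apply Rinv_0_lt_compat.
    split.
    + apply Rmult_le_pos; [apply pow_le |]; lra.
    + apply Rle_trans with (INR j ^ j * exp (/ x) * / exp (/ x));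
        [apply Rmult_le_compat_r; lra | right; field; lra].
  - rewrite flat_neg by lra; split; [lra | apply pow_le, pos_INR].
Qed.

(** Since [flat] is bounded, this makes every member quadratically small at 0, hence differentiable
    there with derivative 0. *)
Lemma flat_shift (j : nat) (x : R) : flat j x = x ^ 2 * flat (S (S j)) x.
Proof.
  destruct (Rlt_dec 0 x) as [H | H].
  - rewrite !flat_pos_eq by easy. simpl; field; lra.
  - rewrite !flat_neg by lra; ring.
Qed.

Lemma is_derive_flat (j : nat) (x : R) :
  is_derive (flat j) x (- INR j * flat (S j) x + flat (S (S j)) x).
Proof.
  destruct (total_order_T 0 x) as [[H | H] | H].
  - apply is_derive_ext_loc with (fun x => (/ x) ^ j * exp (- / x)).
    + exists (mkposreal x H); intros y Hy. symmetry; apply flat_pos_eq.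
      unfold ball in Hy; simpl in Hy; unfold AbsRing_ball, abs, minus, plus, opp in Hy; simpl in Hy.
      apply Rabs_def2 in Hy; lra.
    + rewrite !flat_pos_eq by easy. auto_derive; [lra |].
      destruct j as [| j]; [simpl; field; lra |].
      simpl pred. rewrite <- !tech_pow_Rmult. field; lra.
  - subst x. rewrite !flat_neg, Rmult_0_r, Rplus_0_r by lra.
    (* The function is viewed as one on the plane, constant in the second variable, so that the
       quadratic criterion for differentiability can be reused. *)
    apply is_derive_Reals, (differentiable_pt_lim_proj1_1 (flat j) 0 0).
    apply quadratic_differentiable with (INR (S (S j)) ^ (S (S j))).
    intros h k. rewrite (flat_neg j 0), !Rplus_0_l, !Rmult_0_l, Rplus_0_r, !Rminus_0_r by apply Rle_refl.
    rewrite flat_shift. generalize (flat_bounds (S (S j)) h). intros [B1 B2].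
    set (c := INR _ ^ _) in *. rewrite Rabs_right.
    + assert (0 <= h ^ 2) by apply pow2_ge_0. assert (0 <= k ^ 2) by apply pow2_ge_0. nra.
    + apply Rle_ge, Rmult_le_pos; [apply pow2_ge_0 | easy].
  - rewrite !flat_neg, Rmult_0_r, Rplus_0_r by lra.
    apply is_derive_ext_loc with (fun _ => 0); [| apply @is_derive_const].
    assert (H' : 0 < - x) by lra.
    exists (mkposreal _ H'); intros y Hy. symmetry; apply flat_neg.
    unfold ball in Hy; simpl in Hy; unfold AbsRing_ball, abs, minus, plus, opp in Hy; simpl in Hy.
    apply Rabs_def2 in Hy; lra.
Qed.

(* [flat 0 s] and [flat 0 (1 - s)] never vanish together, so this is a bounded smooth function. *)
Definition flat_weight (s : R) : R := / (flat 0 s + flat 0 (1 - s)).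

(** One of [s] and [1 - s] is at least 1/2, and from 1/2 on [flat 0] is at least its value exp (-2)
    there. *)
Lemma flat_sum_lower (s : R) : exp (- 2) <= flat 0 s + flat 0 (1 - s).
Proof.
  assert (A : forall t, 1 / 2 <= t -> exp (- 2) <= flat 0 t).
  { intros t Ht. rewrite flat_pos_eq by lra. simpl; rewrite Rmult_1_l.
    assert (/ t <= / (1 / 2)) by (apply Rinv_le_contravar; lra).
    destruct (Req_dec (/ t) 2) as [Ht2 | Hn].
    - right; f_equal; lra.
    - left; apply exp_increasing; lra. }
  generalize (flat_bounds 0 s) (flat_bounds 0 (1 - s)); intros.
  destruct (Rle_dec (1 / 2) s); [generalize (A s) | generalize (A (1 - s))]; lra.
Qed.

Lemma flat_weight_bounds (s : R) : 0 < flat_weight s <= exp 2.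
Proof.
  assert (H := flat_sum_lower s); assert (He := exp_pos (- 2)).
  unfold flat_weight; split; [apply Rinv_0_lt_compat; lra |].
  rewrite <- (Ropp_involutive 2), exp_Ropp. now apply Rinv_le_contravar.
Qed.

Lemma is_derive_flat_weight (s : R) :
  is_derive flat_weight s (- (flat 2 s - flat 2 (1 - s)) * flat_weight s ^ 2).
Proof.
  unfold flat_weight.
  assert (H := flat_sum_lower s); assert (He := exp_pos (- 2)).
  replace (- (flat 2 s - flat 2 (1 - s)) * (/ (flat 0 s + flat 0 (1 - s))) ^ 2)
    with (- (flat 2 s - flat 2 (1 - s)) / (flat 0 s + flat 0 (1 - s)) ^ 2) by (field; lra).
  apply (is_derive_inv (fun s => flat 0 s + flat 0 (1 - s))); [| lra].
  apply (is_derive_plus (fun s => flat 0 s) (fun s => flat 0 (1 - s)) s (flat 2 s) (- flat 2 (1 - s))).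
  - generalize (is_derive_flat 0 s); simpl. now rewrite Ropp_0, Rmult_0_l, Rplus_0_l.
  - generalize (is_derive_comp (flat 0) (fun s => 1 - s) s _ (-1) (is_derive_flat 0 (1 - s))).
    intros K. replace (- flat 2 (1 - s)) with (scal (-1) (- INR 0 * flat 1 (1 - s) + flat 2 (1 - s))).
    + apply K. auto_derive; [easy | ring].
    + unfold scal; simpl; unfold mult; simpl; ring.
Qed.

(** A smooth step, equal to 1 for s <= 0 and to 0 for s >= 1. The product form matches the
    generators [ta_flat'] and [ta_weight] of [term_algebra]. *)
Definition cutoff (s : R) : R := flat 0 (1 - s) * flat_weight s.

Lemma cutoff_compl (s : R) : cutoff s = 1 - flat 0 s * flat_weight s.
Proof.
  unfold cutoff, flat_weight.
  assert (H := flat_sum_lower s); assert (He := exp_pos (- 2)). field; lra.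
Qed.

Lemma cutoff_eq_1 (s : R) : s <= 0 -> cutoff s = 1.
Proof. intros H; rewrite cutoff_compl, flat_neg by easy; ring. Qed.

(** The endpoint [s = 0] matters: it corresponds to the boundary circle, so the cutoff leaves the
    normal derivative undisturbed. *)
Lemma is_derive_cutoff_0 (s : R) : s <= 0 -> is_derive cutoff s 0.
Proof.
  intros H.
  apply is_derive_ext with (fun s => 1 - flat 0 s * flat_weight s).
  { intros; symmetry; apply cutoff_compl. }
  assert (D : is_derive (fun s => flat 0 s * flat_weight s) s 0).
  { generalize (is_derive_mult (flat 0) flat_weight s _ _ (is_derive_flat 0 s)
      (is_derive_flat_weight s) Rmult_comm).
    rewrite !(flat_neg _ s) by easy. unfold plus, mult; simpl.
    match goal with |- is_derive _ _ ?a -> _ => replace a with 0 by ring end. easy. }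
  replace 0 with (0 - 0) by ring.
  apply (is_derive_minus (fun _ => 1) (fun s => flat 0 s * flat_weight s) s 0 0);
    [apply @is_derive_const | exact D].
Qed.

(** Real and imaginary parts of (x + iy)^m as polynomials, so that nothing special happens at the
    origin, where polar coordinates are singular. *)
Fixpoint zre (m : nat) (x y : R) : R :=
  match m with O => 1 | S m => x * zre m x y - y * zim m x y end
with zim (m : nat) (x y : R) : R :=
  match m with O => 0 | S m => x * zim m x y + y * zre m x y end.

Lemma zpow_polar (m : nat) (r t : R) :
  zre m (r * cos t) (r * sin t) = r ^ m * cos (INR m * t) /\
  zim m (r * cos t) (r * sin t) = r ^ m * sin (INR m * t).
Proof.
  induction m as [| m [IH1 IH2]].
  - simpl; rewrite Rmult_0_l, cos_0, sin_0; lra.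
  - rewrite S_INR. replace ((INR m + 1) * t) with (INR m * t + t) by ring.
    rewrite cos_plus, sin_plus. simpl zre; simpl zim. rewrite IH1, IH2; simpl.
    split; ring.
Qed.

Lemma zpow_rot (m : nat) (a x y : R) :
  zre m (cos a * x - sin a * y) (sin a * x + cos a * y)
    = cos (INR m * a) * zre m x y - sin (INR m * a) * zim m x y /\
  zim m (cos a * x - sin a * y) (sin a * x + cos a * y)
    = sin (INR m * a) * zre m x y + cos (INR m * a) * zim m x y.
Proof.
  induction m as [| m [IH1 IH2]].
  - simpl; rewrite Rmult_0_l, cos_0, sin_0; lra.
  - rewrite S_INR. replace ((INR m + 1) * a) with (INR m * a + a) by ring.
    rewrite cos_plus, sin_plus. simpl zre; simpl zim. rewrite IH1, IH2; simpl.
    split; ring.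
Qed.

Lemma zpow_norm (m : nat) (x y : R) :
  zre m x y ^ 2 + zim m x y ^ 2 = (x ^ 2 + y ^ 2) ^ m.
Proof.
  induction m as [| m IH]; [simpl; ring |].
  rewrite <- (tech_pow_Rmult _ m), <- IH. simpl zre; simpl zim; ring.
Qed.

Lemma has_grad_mult (f fx fy g gx gy : R -> R -> R) :
  has_grad f fx fy -> has_grad g gx gy ->
  has_grad (fun x y => f x y * g x y) (fun x y => fx x y * g x y + f x y * gx x y)
    (fun x y => fy x y * g x y + f x y * gy x y).
Proof.
  intros Hf Hg X Y t dX dY HX HY.
  match goal with |- is_derive _ _ ?a => replace a with
     ((fx (X t) (Y t) * dX + fy (X t) (Y t) * dY) * g (X t) (Y t)
     + f (X t) (Y t) * (gx (X t) (Y t) * dX + gy (X t) (Y t) * dY)) by ring end.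
  apply (is_derive_mult (fun s => f (X s) (Y s)) (fun s => g (X s) (Y s)));
    [now apply Hf | now apply Hg | exact Rmult_comm].
Qed.

Lemma has_grad_comp (phi dphi : R -> R) (f fx fy : R -> R -> R) :
  (forall s, is_derive phi s (dphi s)) -> has_grad f fx fy ->
  has_grad (fun x y => phi (f x y)) (fun x y => dphi (f x y) * fx x y)
    (fun x y => dphi (f x y) * fy x y).
Proof.
  intros Hp Hf X Y t dX dY HX HY.
  generalize (is_derive_comp phi (fun s => f (X s) (Y s)) t _ _ (Hp _) (Hf X Y t dX dY HX HY)).
  unfold scal; simpl; unfold mult; simpl.
  match goal with |- is_derive _ _ ?a -> is_derive _ _ ?b => replace a with b by ring end.
  easy.
Qed.

Lemma has_grad_const (c : R) :
  has_grad (fun _ _ => c) (fun _ _ => 0) (fun _ _ => 0).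
Proof.
  intros X Y t dX dY _ _. rewrite !Rmult_0_l, Rplus_0_r. apply @is_derive_const.
Qed.

Lemma has_grad_fst : has_grad (fun x _ => x) (fun _ _ => 1) (fun _ _ => 0).
Proof. intros X Y t dX dY HX _. now rewrite Rmult_1_l, Rmult_0_l, Rplus_0_r. Qed.

Lemma has_grad_snd : has_grad (fun _ y => y) (fun _ _ => 0) (fun _ _ => 1).
Proof. intros X Y t dX dY _ HY. now rewrite Rmult_1_l, Rmult_0_l, Rplus_0_l. Qed.

Lemma has_grad_ext (f fx fy g gx gy : R -> R -> R) :
  has_grad f fx fy -> (forall x y, f x y = g x y) -> (forall x y, fx x y = gx x y) ->
  (forall x y, fy x y = gy x y) -> has_grad g gx gy.
Proof.
  intros H E Ex Ey X Y t dX dY HX HY. rewrite <- Ex, <- Ey.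
  apply is_derive_ext with (fun s => f (X s) (Y s)); [intros; apply E | now apply H].
Qed.

(** The complex derivative m z^(m-1) together with the Cauchy-Riemann equations. For [m = 0] the
    exponent is truncated to 0, but the factor [INR m] vanishes. *)
Lemma zpow_has_grad (m : nat) :
  has_grad (zre m) (fun x y => INR m * zre (m - 1) x y) (fun x y => - (INR m * zim (m - 1) x y)) /\
  has_grad (zim m) (fun x y => INR m * zim (m - 1) x y) (fun x y => INR m * zre (m - 1) x y).
Proof.
  induction m as [| m [IH1 IH2]].
  - split; [apply (has_grad_ext _ _ _ _ _ _ (has_grad_const 1))
           | apply (has_grad_ext _ _ _ _ _ _ (has_grad_const 0))]; intros; simpl; ring.
  - assert (M1 := has_grad_mult _ _ _ _ _ _ has_grad_fst IH1).
    assert (M2 := has_grad_mult _ _ _ _ _ _ has_grad_snd IH2).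
    assert (M3 := has_grad_mult _ _ _ _ _ _ has_grad_fst IH2).
    assert (M4 := has_grad_mult _ _ _ _ _ _ has_grad_snd IH1).
    assert (M5 := has_grad_mult _ _ _ _ _ _ (has_grad_const (-1)) M2).
    replace (S m - 1)%nat with m by lia.
    split; [generalize (has_grad_plus _ _ _ _ _ _ M1 M5) | generalize (has_grad_plus _ _ _ _ _ _ M3 M4)];
      intros M; (apply (has_grad_ext _ _ _ _ _ _ M); intros x y;
      [simpl; ring | |]); rewrite S_INR; (destruct m as [| m];
      [simpl; ring | replace (S m - 1)%nat with m by lia; simpl zre; simpl zim; ring]).
Qed.

Lemma has_grad_scale (c : R) (f fx fy : R -> R -> R) :
  has_grad f fx fy ->
  has_grad (fun x y => f (x / c) (y / c)) (fun x y => fx (x / c) (y / c) / c)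
    (fun x y => fy (x / c) (y / c) / c).
Proof.
  intros H X Y t dX dY HX HY.
  replace (_ + _) with (fx (X t / c) (Y t / c) * (dX / c) + fy (X t / c) (Y t / c) * (dY / c))
    by (unfold Rdiv; ring).
  apply (H (fun s => X s / c) (fun s => Y s / c)).
  - apply is_derive_ext with (fun s => / c * X s); [intros; apply Rmult_comm |].
    replace (dX / c) with (/ c * dX) by apply Rmult_comm. now apply is_derive_scal.
  - apply is_derive_ext with (fun s => / c * Y s); [intros; apply Rmult_comm |].
    replace (dY / c) with (/ c * dY) by apply Rmult_comm. now apply is_derive_scal.
Qed.

(** * Truncated modes *)

(* Negative exactly in the open disk of radius [k]; the modes are cut off where it exceeds 1. *)
Definition collar (k n : nat) (x y : R) : R :=
  (INR (k * n) + 1) * ((x / INR k) ^ 2 + (y / INR k) ^ 2 - 1).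

(* A class containing the truncated modes and closed under partial derivatives.  Its members
   are polynomially bounded in [n] only where [collar <= 1], hence [collared] below. *)
Inductive term_algebra (k : nat) : (nat -> R -> R -> R) -> Prop :=
| ta_seq (a : nat -> R) :
    (exists C p, forall n, Rabs (a n) <= C * (INR n + 1) ^ p) ->
    term_algebra k (fun n _ _ => a n)
| ta_x : term_algebra k (fun _ x _ => x)
| ta_y : term_algebra k (fun _ _ y => y)
| ta_zre (i : nat) : term_algebra k (fun n x y => zre (k * n - i) (x / INR k) (y / INR k))
| ta_zim (i : nat) : term_algebra k (fun n x y => zim (k * n - i) (x / INR k) (y / INR k))
| ta_flat (j : nat) : term_algebra k (fun n x y => flat j (collar k n x y))
| ta_flat' (j : nat) : term_algebra k (fun n x y => flat j (1 - collar k n x y))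
| ta_weight : term_algebra k (fun n x y => flat_weight (collar k n x y))
| ta_plus H K : term_algebra k H -> term_algebra k K ->
    term_algebra k (fun n x y => H n x y + K n x y)
| ta_mult H K : term_algebra k H -> term_algebra k K ->
    term_algebra k (fun n x y => H n x y * K n x y).

Lemma ta_const (k : nat) (c : R) : term_algebra k (fun _ _ _ => c).
Proof.
  apply (ta_seq k (fun _ => c)). exists (Rabs c), O; intros n; simpl; lra.
Qed.

(** Differentiation produces two factors growing with [n]: the exponent of a power, obtained from
    this through [ta_degree], and the steepness of the collar, which is the case [i = 0]; hence the
    [- 0] in [collar_has_grad]. *)
Lemma ta_affine (k : nat) (c : R) (i : nat) : term_algebra k (fun n _ _ => c * (INR (k * n - i) + 1)).
Proof.
  apply (ta_seq k (fun n => c * (INR (k * n - i) + 1))).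
  exists (Rabs c * (INR k + 1)), 1%nat; intros n. rewrite Rabs_mult, pow_1, Rmult_assoc.
  apply Rmult_le_compat_l; [apply Rabs_pos |].
  rewrite Rabs_right by (generalize (pos_INR (k * n - i)); lra).
  apply Rle_trans with (INR (k * n) + 1).
  - apply Rplus_le_compat_r, le_INR; lia.
  - rewrite mult_INR. generalize (pos_INR n) (pos_INR k); nra.
Qed.

Lemma ta_degree (k : nat) (i : nat) : term_algebra k (fun n _ _ => INR (k * n - i)).
Proof.
  replace (fun n (_ _ : R) => INR (k * n - i)) with
    (fun n (_ _ : R) => 1 * (INR (k * n - i) + 1) + -1) by
    (extensionality n; extensionality x; extensionality y; ring).
  apply ta_plus; [apply ta_affine | apply ta_const].
Qed.

Lemma collar_has_grad (k n : nat) :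
  has_grad (collar k n)
    (fun x y => (2 / INR k / INR k) * (INR (k * n - 0) + 1) * x)
    (fun x y => (2 / INR k / INR k) * (INR (k * n - 0) + 1) * y).
Proof.
  rewrite Nat.sub_0_r.
  intros X Y t dX dY HX HY. unfold collar.
  auto_derive.
  - repeat split; [now exists dX | now exists dY].
  - replace (Derive (fun x : R => X x) t) with dX by (symmetry; exact (is_derive_unique X t dX HX)).
    replace (Derive (fun x : R => Y x) t) with dY by (symmetry; exact (is_derive_unique Y t dY HY)).
    unfold Rdiv; ring.
Qed.

Lemma ta_collar_x (k : nat) :
  term_algebra k (fun n x y => (2 / INR k / INR k) * (INR (k * n - 0) + 1) * x).
Proof. apply ta_mult; [apply ta_affine | apply ta_x]. Qed.

Lemma ta_collar_y (k : nat) :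
  term_algebra k (fun n x y => (2 / INR k / INR k) * (INR (k * n - 0) + 1) * y).
Proof. apply ta_mult; [apply ta_affine | apply ta_y]. Qed.

Lemma ta_comp_collar (k : nat) (phi dphi : R -> R) :
  (forall s, is_derive phi s (dphi s)) ->
  term_algebra k (fun n x y => dphi (collar k n x y)) ->
  exists Hx Hy, term_algebra k Hx /\ term_algebra k Hy /\
    forall n, has_grad (fun x y => phi (collar k n x y)) (Hx n) (Hy n).
Proof.
  intros D A. eexists; eexists; split; [| split].
  3: intros n; apply (has_grad_comp phi dphi); [exact D | apply collar_has_grad].
  - apply (ta_mult k _ _ A (ta_collar_x k)).
  - apply (ta_mult k _ _ A (ta_collar_y k)).
Qed.

Lemma ta_grad (k : nat) (H : nat -> R -> R -> R) :
  term_algebra k H -> exists Hx Hy, term_algebra k Hx /\ term_algebra k Hy /\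
    forall n, has_grad (H n) (Hx n) (Hy n).
Proof.
  assert (A0 := ta_const k 0). assert (A1 := ta_const k 1). assert (Am := ta_const k (-1)).
  induction 1 as [a Ha | | | i | i | j | j | | H K _ IH1 _ IH2 | H K TH IH1 TK IH2].
  - exists (fun _ _ _ => 0), (fun _ _ _ => 0); split; [easy | split; [easy |]].
    intros n; apply has_grad_const.
  - exists (fun _ _ _ => 1), (fun _ _ _ => 0); split; [easy | split; [easy |]].
    intros n; apply has_grad_fst.
  - exists (fun _ _ _ => 0), (fun _ _ _ => 1); split; [easy | split; [easy |]].
    intros n; apply has_grad_snd.
  - exists (fun n x y => / INR k * (INR (k * n - i) * zre (k * n - S i) (x / INR k) (y / INR k))),
      (fun n x y => - / INR k * (INR (k * n - i) * zim (k * n - S i) (x / INR k) (y / INR k))).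
    split; [| split].
    + apply (ta_mult k _ _ (ta_const k (/ INR k)) (ta_mult k _ _ (ta_degree k i) (ta_zre k (S i)))).
    + apply (ta_mult k _ _ (ta_const k (- / INR k)) (ta_mult k _ _ (ta_degree k i) (ta_zim k (S i)))).
    + intros n. apply (has_grad_ext _ _ _ _ _ _ (has_grad_scale (INR k) _ _ _ (proj1 (zpow_has_grad (k * n - i)))));
        intros; replace (k * n - i - 1)%nat with (k * n - S i)%nat by lia; unfold Rdiv; ring.
  - exists (fun n x y => / INR k * (INR (k * n - i) * zim (k * n - S i) (x / INR k) (y / INR k))),
      (fun n x y => / INR k * (INR (k * n - i) * zre (k * n - S i) (x / INR k) (y / INR k))).
    split; [| split].
    + apply (ta_mult k _ _ (ta_const k (/ INR k)) (ta_mult k _ _ (ta_degree k i) (ta_zim k (S i)))).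
    + apply (ta_mult k _ _ (ta_const k (/ INR k)) (ta_mult k _ _ (ta_degree k i) (ta_zre k (S i)))).
    + intros n. apply (has_grad_ext _ _ _ _ _ _ (has_grad_scale (INR k) _ _ _ (proj2 (zpow_has_grad (k * n - i)))));
        intros; replace (k * n - i - 1)%nat with (k * n - S i)%nat by lia; unfold Rdiv; ring.
  - apply (ta_comp_collar k (flat j) _ (is_derive_flat j)).
    apply (ta_plus k (fun n x y => - INR j * flat (S j) (collar k n x y))
             (fun n x y => flat (S (S j)) (collar k n x y))); [| apply ta_flat].
    apply (ta_mult k (fun _ _ _ => - INR j)); [apply ta_const | apply ta_flat].
  (* The algebra is generated by sums and products only, so signs are written as factors [-1]. *)
  - apply (ta_comp_collar k (fun s => flat j (1 - s))
             (fun s => -1 * (- INR j * flat (S j) (1 - s) + flat (S (S j)) (1 - s)))).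
    + intros s.
      apply (is_derive_comp (flat j) (fun s => 1 - s) s _ (-1) (is_derive_flat j (1 - s))).
      auto_derive; [easy | ring].
    + apply (ta_mult k (fun _ _ _ => -1)); [easy |].
      apply (ta_plus k (fun n x y => - INR j * flat (S j) (1 - collar k n x y))
             (fun n x y => flat (S (S j)) (1 - collar k n x y))); [| apply ta_flat'].
      apply (ta_mult k (fun _ _ _ => - INR j)); [apply ta_const | apply ta_flat'].
  - apply (ta_comp_collar k flat_weight
             (fun s => (-1 * (flat 2 s + -1 * flat 2 (1 - s))) * (flat_weight s * flat_weight s))).
    + intros s.
      replace (-1 * (flat 2 s + -1 * flat 2 (1 - s)) * (flat_weight s * flat_weight s))
        with (- (flat 2 s - flat 2 (1 - s)) * flat_weight s ^ 2) by ring.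
      apply is_derive_flat_weight.
    + apply (ta_mult k (fun n x y => -1 * (flat 2 (collar k n x y) + -1 * flat 2 (1 - collar k n x y)))
               (fun n x y => flat_weight (collar k n x y) * flat_weight (collar k n x y))).
      * apply (ta_mult k _ _ Am). apply (ta_plus k _ _ (ta_flat k 2)).
        apply (ta_mult k _ _ Am (ta_flat' k 2)).
      * apply (ta_mult k _ _ (ta_weight k) (ta_weight k)).
  - destruct IH1 as [Hx [Hy [TH1 [TH2 GH]]]]. destruct IH2 as [Kx [Ky [TK1 [TK2 GK]]]].
    exists (fun n x y => Hx n x y + Kx n x y), (fun n x y => Hy n x y + Ky n x y).
    split; [now apply ta_plus | split; [now apply ta_plus |]].
    intros n; apply (has_grad_plus _ _ _ _ _ _ (GH n) (GK n)).
  - destruct IH1 as [Hx [Hy [TH1 [TH2 GH]]]]. destruct IH2 as [Kx [Ky [TK1 [TK2 GK]]]].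
    exists (fun n x y => Hx n x y * K n x y + H n x y * Kx n x y),
      (fun n x y => Hy n x y * K n x y + H n x y * Ky n x y).
    split; [| split].
    + apply (ta_plus k _ _ (ta_mult k _ _ TH1 TK) (ta_mult k _ _ TH TK1)).
    + apply (ta_plus k _ _ (ta_mult k _ _ TH2 TK) (ta_mult k _ _ TH TK2)).
    + intros n; apply (has_grad_mult _ _ _ _ _ _ (GH n) (GK n)).
Qed.

Lemma collar_rho (k n : nat) (x y : R) :
  collar k n x y <= 1 ->
  (x / INR k) ^ 2 + (y / INR k) ^ 2 <= 1 + / (INR (k * n) + 1).
Proof.
  unfold collar; intros H. set (N := INR (k * n) + 1) in *.
  assert (HN : 0 < N) by (unfold N; generalize (pos_INR (k * n)); lra).
  apply (Rmult_le_reg_l N); [easy |].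
  replace (N * (1 + / N)) with (N + 1) by (field; lra). lra.
Qed.

(** Where [collar] is at most 1 the point stays in a fixed bounded region, and the powers stay
    bounded although their exponent grows. The other generators are polynomial in [n] or bounded
    everywhere. *)
Lemma ta_bound (k : nat) (H : nat -> R -> R -> R) : (1 <= k)%nat ->
  term_algebra k H -> exists C p, 0 <= C /\ forall n x y,
    collar k n x y <= 1 -> Rabs (H n x y) <= C * (INR n + 1) ^ p.
Proof.
  intros Hk.
  assert (HK : 0 < INR k) by (apply lt_0_INR; lia).
  assert (cst : forall (F : nat -> R -> R -> R) C,
     (forall n x y, collar k n x y <= 1 -> Rabs (F n x y) <= C) ->
     exists C p, 0 <= C /\ forall n x y,
       collar k n x y <= 1 -> Rabs (F n x y) <= C * (INR n + 1) ^ p).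
  { intros F C B; exists (Rabs C), O; split; [apply Rabs_pos | intros n x y L]. simpl.
    generalize (B n x y L) (Rle_abs C); lra. }
  assert (Brho : forall n x y, collar k n x y <= 1 -> (x / INR k) ^ 2 + (y / INR k) ^ 2 <= 2).
  { intros n x y L. apply collar_rho in L.
    assert (/ (INR (k * n) + 1) <= / 1)
      by (apply Rinv_le_contravar; generalize (pos_INR (k * n)); lra).
    lra. }
  assert (Babs : forall x, (x / INR k) ^ 2 <= 2 -> Rabs x <= 2 * INR k).
  { intros x Hx. assert (Ex : x = x / INR k * INR k) by (field; lra).
    rewrite Ex, Rabs_mult, (Rabs_right (INR k)) by lra.
    apply Rmult_le_compat_r; [lra |]. apply Rabs_le. nra. }
  assert (Bz : forall n i x y, collar k n x y <= 1 ->
     Rabs (zre (k * n - i) (x / INR k) (y / INR k)) <= 2 /\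
     Rabs (zim (k * n - i) (x / INR k) (y / INR k)) <= 2).
  { intros n i x y L. apply collar_rho in L.
    set (u := x / INR k) in *; set (v := y / INR k) in *.
    (* [(1 + 1/N)^N <= e] with [N = kn + 1] *)
    assert (B4 : (u ^ 2 + v ^ 2) ^ (k * n - i) <= 3).
    { assert (HN : 0 < INR (k * n) + 1) by (generalize (pos_INR (k * n)); lra).
      assert (Hi : 0 < / (INR (k * n) + 1)) by now apply Rinv_0_lt_compat.
      apply Rle_trans with ((1 + / (INR (k * n) + 1)) ^ (k * n - i)).
      { apply pow_incr; split; [| easy]. generalize (pow2_ge_0 u) (pow2_ge_0 v); lra. }
      apply Rle_trans with ((1 + / (INR (k * n) + 1)) ^ (S (k * n))).
      { apply Rle_pow; [lra | lia]. }
      apply Rle_trans with (exp (/ (INR (k * n) + 1)) ^ (S (k * n))).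
      { apply pow_incr; split; [lra | apply exp_ineq1_le]. }
      rewrite <- Rpower_pow by apply exp_pos. unfold Rpower. rewrite ln_exp, S_INR, Rinv_r by lra.
      apply exp_le_3. }
    rewrite <- zpow_norm in B4.
    split; apply Rabs_le; nra. }
  induction 1 as [a Ha | | | i | i | j | j | | H K _ IH1 _ IH2 | H K TH IH1 TK IH2].
  - destruct Ha as [C [p Ha]]. exists (Rabs C), p; split; [apply Rabs_pos |].
    intros n x y _. eapply Rle_trans; [apply Ha |].
    apply Rmult_le_compat_r; [apply pow_le; generalize (INR_succ_ge_1 n); lra | apply Rle_abs].
  - apply cst with (2 * INR k); intros n x y L. apply Babs.
    generalize (Brho n x y L) (pow2_ge_0 (y / INR k)); lra.
  - apply cst with (2 * INR k); intros n x y L. apply Babs.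
    generalize (Brho n x y L) (pow2_ge_0 (x / INR k)); lra.
  - apply cst with 2; intros n x y L. now apply Bz.
  - apply cst with 2; intros n x y L. now apply Bz.
  - apply cst with (INR j ^ j); intros n x y _.
    generalize (flat_bounds j (collar k n x y)); intros. rewrite Rabs_right; lra.
  - apply cst with (INR j ^ j); intros n x y _.
    generalize (flat_bounds j (1 - collar k n x y)); intros. rewrite Rabs_right; lra.
  - apply cst with (exp 2); intros n x y _.
    generalize (flat_weight_bounds (collar k n x y)); intros. rewrite Rabs_right; lra.
  - destruct IH1 as [C [p [HC B1]]], IH2 as [D [q [HD B2]]].
    exists (C + D), (p + q)%nat; split; [lra | intros n x y L].
    assert (Hn := INR_succ_ge_1 n).
    eapply Rle_trans; [apply Rabs_triang |].
    generalize (B1 n x y L) (B2 n x y L)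
      (Rmult_le_compat_l C _ _ HC (Rle_pow (INR n + 1) p (p + q) Hn ltac:(lia)))
      (Rmult_le_compat_l D _ _ HD (Rle_pow (INR n + 1) q (p + q) Hn ltac:(lia))). lra.
  - destruct IH1 as [C [p [HC B1]]], IH2 as [D [q [HD B2]]].
    exists (C * D), (p + q)%nat; split; [now apply Rmult_le_pos | intros n x y L].
    rewrite Rabs_mult, pow_add.
    replace (C * D * _) with ((C * (INR n + 1) ^ p) * (D * (INR n + 1) ^ q)) by ring.
    apply Rmult_le_compat; try apply Rabs_pos; [now apply B1 | now apply B2].
Qed.

(** The strict inequality makes the vanishing region open, so that partial derivatives vanish there
    too and the class is again closed under them. *)
Definition collared (k : nat) (H : nat -> R -> R -> R) : Prop :=
  term_algebra k H /\ forall n x y, 1 < collar k n x y -> H n x y = 0.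

Lemma collar_continuity_x (k n : nat) (x y : R) :
  continuous (fun t => collar k n t y) x.
Proof.
  apply (ex_derive_continuous (V := R_NormedModule)).
  eexists; eapply has_grad_x, collar_has_grad.
Qed.

Lemma collar_continuity_y (k n : nat) (x y : R) :
  continuous (fun t => collar k n x t) y.
Proof.
  apply (ex_derive_continuous (V := R_NormedModule)).
  eexists; eapply has_grad_y, collar_has_grad.
Qed.

(** Derivatives are local, and the region is open as the preimage of an open set under [collar]. It
    serves twice: beyond the collar, to compare with 0, and inside the disk, to compare a truncated
    mode with the power itself. *)
Lemma has_grad_eq_open (D : R -> Prop) (k n : nat) (f fx fy g gx gy : R -> R -> R) :
  open D -> has_grad f fx fy -> has_grad g gx gy ->
  (forall x y, D (collar k n x y) -> f x y = g x y) ->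
  forall x y, D (collar k n x y) -> fx x y = gx x y /\ fy x y = gy x y.
Proof.
  intros HD Hf Hg E x y Hxy. split.
  - rewrite <- (is_derive_unique _ _ _ (has_grad_x f fx fy x y Hf)).
    rewrite <- (is_derive_unique _ _ _ (has_grad_x g gx gy x y Hg)).
    apply Derive_ext_loc.
    assert (L : locally x (fun t => D (collar k n t y)))
      by exact (collar_continuity_x k n x y D (HD _ Hxy)).
    revert L; apply filter_imp; intros t; apply E.
  - rewrite <- (is_derive_unique _ _ _ (has_grad_y f fx fy x y Hf)).
    rewrite <- (is_derive_unique _ _ _ (has_grad_y g gx gy x y Hg)).
    apply Derive_ext_loc.
    assert (L : locally y (fun t => D (collar k n x t)))
      by exact (collar_continuity_y k n x y D (HD _ Hxy)).
    revert L; apply filter_imp; intros t; apply E.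
Qed.

Lemma collared_tame (k : nat) : (1 <= k)%nat -> tame_class (collared k).
Proof.
  intros Hk; split; intros H [TH ZH].
  - destruct (ta_bound k H Hk TH) as [C [p [HC B]]].
    exists C, p; intros n x y. destruct (Rle_dec (collar k n x y) 1) as [L | L].
    + now apply B.
    + rewrite ZH, Rabs_R0 by lra. apply Rmult_le_pos; [easy |].
      apply pow_le; generalize (INR_succ_ge_1 n); lra.
  - destruct (ta_grad k H TH) as [Hx [Hy [Tx [Ty G]]]].
    assert (Z : forall n x y, 1 < collar k n x y -> Hx n x y = 0 /\ Hy n x y = 0).
    { intros n x y L.
      apply (has_grad_eq_open (fun s => 1 < s) k n (H n) (Hx n) (Hy n) _ _ _ (open_gt 1)
               (G n) (has_grad_const 0)); [apply ZH | easy]. }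
    exists Hx, Hy; split; [| split; [| exact G]]; (split; [easy |]); intros n x y L; now apply Z.
Qed.

Definition cos_mode (k n : nat) (x y : R) : R :=
  zre (k * n) (x / INR k) (y / INR k) * cutoff (collar k n x y).

Definition sin_mode (k n : nat) (x y : R) : R :=
  zim (k * n) (x / INR k) (y / INR k) * cutoff (collar k n x y).

Lemma collared_cutoff (k : nat) (H : nat -> R -> R -> R) :
  term_algebra k H -> collared k (fun n x y => H n x y * cutoff (collar k n x y)).
Proof.
  intros TH; split.
  - apply (ta_mult k _ _ TH (ta_mult k _ _ (ta_flat' k 0) (ta_weight k))).
  - intros n x y L. unfold cutoff. rewrite flat_neg by lra. ring.
Qed.

Lemma collared_cos_mode (k : nat) : collared k (cos_mode k).
Proof.
  apply collared_cutoff.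
  replace (fun n x y => zre (k * n) (x / INR k) (y / INR k))
    with (fun n x y => zre (k * n - 0) (x / INR k) (y / INR k))
    by (extensionality n; now rewrite Nat.sub_0_r).
  apply ta_zre.
Qed.

Lemma collared_sin_mode (k : nat) : collared k (sin_mode k).
Proof.
  apply collared_cutoff.
  replace (fun n x y => zim (k * n) (x / INR k) (y / INR k))
    with (fun n x y => zim (k * n - 0) (x / INR k) (y / INR k))
    by (extensionality n; now rewrite Nat.sub_0_r).
  apply ta_zim.
Qed.

Lemma collar_neg (k n : nat) (x y : R) : (1 <= k)%nat ->
  collar k n x y < 0 <-> x ^ 2 + y ^ 2 < INR k ^ 2.
Proof.
  intros Hk. assert (HK : 0 < INR k) by (apply lt_0_INR; lia).
  unfold collar. assert (HN : 0 < INR (k * n) + 1) by (generalize (pos_INR (k * n)); lra).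
  assert (HK2 : 0 < INR k ^ 2) by now apply pow_lt.
  replace ((x / INR k) ^ 2 + (y / INR k) ^ 2 - 1) with ((x ^ 2 + y ^ 2 - INR k ^ 2) / INR k ^ 2)
    by (field; lra).
  split; intros H.
  - apply Rnot_le_lt; intros H'.
    assert (0 <= (x ^ 2 + y ^ 2 - INR k ^ 2) / INR k ^ 2)
      by (apply Rdiv_le_0_compat; lra). nra.
  - assert ((x ^ 2 + y ^ 2 - INR k ^ 2) / INR k ^ 2 < 0).
    { apply Rmult_lt_reg_r with (INR k ^ 2); [easy |]. field_simplify; lra. }
    nra.
Qed.

Lemma laplacian_of_grads (f fx fy fxx fxy fyx fyy : R -> R -> R) (x y : R) :
  has_grad f fx fy -> has_grad fx fxx fxy -> has_grad fy fyx fyy ->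
  laplacian f x y = fxx x y + fyy x y.
Proof.
  intros H Hx Hy. unfold laplacian, partial_derive. f_equal.
  - simpl. erewrite Derive_ext; [eapply is_derive_unique, has_grad_x, Hx |].
    intros t; simpl. eapply is_derive_unique, has_grad_x, H.
  - simpl. erewrite Derive_ext; [eapply is_derive_unique, has_grad_y, Hy |].
    intros t; simpl. eapply is_derive_unique, has_grad_y, H.
Qed.

(** The two pure second derivatives are m (m-1) / c^2 times the same part of z^(m-2), with opposite
    signs. Only the existence of the derivatives and this cancellation are needed later. *)
Lemma zpow_harmonic (m : nat) (c : R) :
  exists px py pxx pxy pyx pyy qx qy qxx qxy qyx qyy : R -> R -> R,
    (has_grad (fun x y => zre m (x / c) (y / c)) px py /\
     has_grad px pxx pxy /\ has_grad py pyx pyy /\ (forall x y, pxx x y + pyy x y = 0)) /\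
    (has_grad (fun x y => zim m (x / c) (y / c)) qx qy /\
     has_grad qx qxx qxy /\ has_grad qy qyx qyy /\ (forall x y, qxx x y + qyy x y = 0)).
Proof.
  destruct (zpow_has_grad m) as [P Q]. destruct (zpow_has_grad (m - 1)) as [P1 Q1].
  assert (Sc : forall a f fx fy, has_grad f fx fy ->
     has_grad (fun x y => a * f (x / c) (y / c) / c) (fun x y => a * (fx (x / c) (y / c) / c) / c)
       (fun x y => a * (fy (x / c) (y / c) / c) / c)).
  { intros a f fx fy G.
    apply (has_grad_ext _ _ _ _ _ _ (has_grad_mult _ _ _ _ _ _ (has_grad_const (a / c))
             (has_grad_scale c _ _ _ G))); intros; unfold Rdiv; ring. }
  assert (P' := has_grad_scale c _ _ _ P). assert (Q' := has_grad_scale c _ _ _ Q).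
  do 12 eexists; split; (split; [| split; [| split]]).
  - apply (has_grad_ext _ _ _ _ _ _ P'); [easy | easy | ].
    intros x y. instantiate (1 := fun x y => - INR m * zim (m - 1) (x / c) (y / c) / c).
    unfold Rdiv; ring.
  - apply Sc, P1.
  - apply Sc, Q1.
  - intros x y; simpl. unfold Rdiv; ring.
  - exact Q'.
  - apply Sc, Q1.
  - apply Sc, P1.
  - intros x y; simpl. unfold Rdiv; ring.
Qed.

(** * The harmonic extension *)

Definition extension (k : nat) (a b : nat -> R) (x y : R) : R :=
  fsum a (cos_mode k) x y + fsum b (sin_mode k) x y.

Definition trig_sum (a b : nat -> R) (s : R) : R :=
  Series (fun n => a n * cos (INR n * s) + b n * sin (INR n * s)).

Lemma extension_smooth2 (k : nat) (a b : nat -> R) :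
  (1 <= k)%nat -> rapid a -> rapid b -> smooth2 (extension k a b).
Proof.
  intros Hk Ha Hb. apply fsum_smooth2 with (collared k); try easy.
  - now apply collared_tame.
  - apply collared_cos_mode.
  - apply collared_sin_mode.
Qed.

(** [tame_class] provides the derivatives of a mode only existentially. They are identified with
    those of the power [p] by agreement on the open disk, once for each order. *)
Lemma harmonic_on_collar_neg (k n : nat)
    (f fx fy fxx fxy fyx fyy p px py pxx pxy pyx pyy : R -> R -> R) :
  has_grad f fx fy -> has_grad fx fxx fxy -> has_grad fy fyx fyy ->
  has_grad p px py -> has_grad px pxx pxy -> has_grad py pyx pyy ->
  (forall x y, collar k n x y < 0 -> f x y = p x y) ->
  (forall x y, pxx x y + pyy x y = 0) ->
  forall x y, collar k n x y < 0 -> fxx x y + fyy x y = 0.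
Proof.
  intros F Fx Fy P Px Py E Hp x y Hxy.
  assert (E1 := has_grad_eq_open (fun s => s < 0) k n _ _ _ _ _ _ (open_lt 0) F P E).
  rewrite (proj1 (has_grad_eq_open (fun s => s < 0) k n _ _ _ _ _ _ (open_lt 0) Fx Px
             (fun u v L => proj1 (E1 u v L)) x y Hxy)).
  rewrite (proj2 (has_grad_eq_open (fun s => s < 0) k n _ _ _ _ _ _ (open_lt 0) Fy Py
             (fun u v L => proj2 (E1 u v L)) x y Hxy)).
  apply Hp.
Qed.

Lemma fsum_laplacian_0 (k : nat) (a : nat -> R) (Hxx Hyy : nat -> R -> R -> R) (x y : R) :
  (1 <= k)%nat -> rapid a -> collared k Hxx -> collared k Hyy ->
  (forall n, Hxx n x y + Hyy n x y = 0) -> fsum a Hxx x y + fsum a Hyy x y = 0.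
Proof.
  intros Hk Ha Txx Tyy E. unfold fsum.
  rewrite <- Series_plus.
  - rewrite (Series_ext _ (fun n => 0 * 0)).
    + rewrite Series_scal_l; ring.
    + intros n. rewrite <- Rmult_plus_distr_l, E; ring.
  - apply ex_series_fsum; [easy | now apply (collared_tame k Hk)].
  - apply ex_series_fsum; [easy | now apply (collared_tame k Hk)].
Qed.

Lemma extension_harmonic (k : nat) (a b : nat -> R) (x y : R) :
  (1 <= k)%nat -> rapid a -> rapid b -> x ^ 2 + y ^ 2 < INR k ^ 2 ->
  laplacian (extension k a b) x y = 0.
Proof.
  intros Hk Ha Hb Hxy.
  assert (HT := collared_tame k Hk). destruct HT as [TB TG].
  assert (HT : tame_class (collared k)) by now split.
  destruct (TG _ (collared_cos_mode k)) as [Hx [Hy [Tx [Ty G]]]].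
  destruct (TG _ Tx) as [Hxx [Hxy' [Txx [Txy Gx]]]].
  destruct (TG _ Ty) as [Hyx [Hyy [Tyx [Tyy Gy]]]].
  destruct (TG _ (collared_sin_mode k)) as [Kx [Ky [Ux [Uy L]]]].
  destruct (TG _ Ux) as [Kxx [Kxy [Uxx [Uxy Lx]]]].
  destruct (TG _ Uy) as [Kyx [Kyy [Uyx [Uyy Ly]]]].
  assert (D : forall c H Hx Hy, rapid c -> collared k H -> collared k Hx -> collared k Hy ->
     (forall n, has_grad (H n) (Hx n) (Hy n)) -> has_grad (fsum c H) (fsum c Hx) (fsum c Hy)).
  { intros. apply differentiable_has_grad. now apply (fsum_differentiable (collared k)). }
  assert (Cc := collared_cos_mode k). assert (Cs := collared_sin_mode k).
  unfold extension.
  erewrite laplacian_of_grads; [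
    | apply has_grad_plus; [apply (D a _ Hx Hy) | apply (D b _ Kx Ky)]; easy
    | apply has_grad_plus; [apply (D a _ Hxx Hxy') | apply (D b _ Kxx Kxy)]; easy
    | apply has_grad_plus; [apply (D a _ Hyx Hyy) | apply (D b _ Kyx Kyy)]; easy ].
  assert (N : forall n, collar k n x y < 0) by (intros; now apply collar_neg).
  assert (E1 : fsum a Hxx x y + fsum a Hyy x y = 0).
  { apply (fsum_laplacian_0 k a Hxx Hyy); try easy.
    intros n.
    destruct (zpow_harmonic (k * n) (INR k))
      as (px & py & pxx & pxy & pyx & pyy & _ & _ & _ & _ & _ & _ & (P & Px & Py & Hp) & _).
    apply (harmonic_on_collar_neg k n _ _ _ _ _ _ _ _ _ _ _ _ _ _
             (G n) (Gx n) (Gy n) P Px Py); try easy.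
    intros u v Huv. unfold cos_mode. rewrite cutoff_eq_1 by lra. ring. }
  assert (E2 : fsum b Kxx x y + fsum b Kyy x y = 0).
  { apply (fsum_laplacian_0 k b Kxx Kyy); try easy.
    intros n.
    destruct (zpow_harmonic (k * n) (INR k))
      as (_ & _ & _ & _ & _ & _ & px & py & pxx & pxy & pyx & pyy & _ & (P & Px & Py & Hp)).
    apply (harmonic_on_collar_neg k n _ _ _ _ _ _ _ _ _ _ _ _ _ _
             (L n) (Lx n) (Ly n) P Px Py); try easy.
    intros u v Huv. unfold sin_mode. rewrite cutoff_eq_1 by lra. ring. }
  lra.
Qed.

(** * Boundary values and normal derivative of the extension *)

Lemma collar_polar (k n : nat) (r t : R) :
  collar k n (r * cos t) (r * sin t) = (INR (k * n) + 1) * ((r / INR k) ^ 2 - 1).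
Proof.
  unfold collar. f_equal.
  transitivity ((r / INR k) ^ 2 * (sin t * sin t + cos t * cos t) - 1); [unfold Rdiv; ring |].
  generalize (sin2_cos2 t); unfold Rsqr; intros ->; ring.
Qed.

Lemma cos_mode_polar (k n : nat) (r t : R) :
  cos_mode k n (r * cos t) (r * sin t)
    = (r / INR k) ^ (k * n) * cos (INR (k * n) * t)
      * cutoff ((INR (k * n) + 1) * ((r / INR k) ^ 2 - 1)).
Proof.
  unfold cos_mode. rewrite collar_polar. f_equal.
  rewrite <- (proj1 (zpow_polar (k * n) (r / INR k) t)). f_equal; unfold Rdiv; ring.
Qed.

Lemma sin_mode_polar (k n : nat) (r t : R) :
  sin_mode k n (r * cos t) (r * sin t)
    = (r / INR k) ^ (k * n) * sin (INR (k * n) * t)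
      * cutoff ((INR (k * n) + 1) * ((r / INR k) ^ 2 - 1)).
Proof.
  unfold sin_mode. rewrite collar_polar. f_equal.
  rewrite <- (proj2 (zpow_polar (k * n) (r / INR k) t)). f_equal; unfold Rdiv; ring.
Qed.

Lemma is_derive_radial_factor (k n : nat) (c : R) : (1 <= k)%nat ->
  is_derive (fun t => ((INR k + t) / INR k) ^ (k * n) * c
      * cutoff ((INR (k * n) + 1) * (((INR k + t) / INR k) ^ 2 - 1))) 0 (INR n * c).
Proof.
  intros Hk. assert (HK : 0 < INR k) by (apply lt_0_INR; lia).
  assert (D1 : is_derive (fun t => ((INR k + t) / INR k) ^ (k * n) * c) 0 (INR n * c)).
  { auto_derive; [easy |]. rewrite Rplus_0_r. unfold Rdiv; rewrite Rinv_r, pow1, mult_INR by lra.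
    field; lra. }
  assert (Z : (INR (k * n) + 1) * (((INR k + 0) / INR k) ^ 2 - 1) = 0)
    by (field; lra).
  assert (D2 : is_derive (fun t => cutoff ((INR (k * n) + 1) * (((INR k + t) / INR k) ^ 2 - 1))) 0 0).
  { set (h := fun t => (INR (k * n) + 1) * (((INR k + t) / INR k) ^ 2 - 1)).
    assert (Dh : is_derive h 0 (Derive h 0)).
    { apply Derive_correct. unfold h. auto_derive. easy. }
    assert (Dc : is_derive cutoff (h 0) 0) by (apply is_derive_cutoff_0; unfold h; lra).
    generalize (is_derive_comp cutoff h 0 _ _ Dc Dh).
    unfold scal; simpl; unfold mult; simpl. now rewrite Rmult_0_r. }
  generalize (is_derive_mult _ _ 0 _ _ D1 D2 Rmult_comm).
  rewrite Z, cutoff_eq_1 by lra. unfold plus, mult; simpl.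
  now rewrite Rmult_1_r, Rmult_0_r, Rplus_0_r.
Qed.

Lemma rapid_scale (a : nat -> R) : rapid a -> rapid (fun n => INR n * a n).
Proof.
  intros Ha p; destruct (Ha (S p)) as [C HC]; exists C; intros n.
  eapply Rle_trans; [| apply HC]. rewrite Rabs_mult, (Rabs_right (INR n)), <- tech_pow_Rmult
    by (apply Rle_ge, pos_INR).
  replace (INR n * Rabs (a n) * (INR n + 1) ^ p) with (Rabs (a n) * (INR n * (INR n + 1) ^ p)) by ring.
  apply Rmult_le_compat_l; [apply Rabs_pos |].
  apply Rmult_le_compat_r; [apply pow_le; generalize (INR_succ_ge_1 n); lra | lra].
Qed.

Lemma extension_boundary (k : nat) (a b : nat -> R) (s : R) :
  (1 <= k)%nat -> rapid a -> rapid b ->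
  extension k a b (INR k * cos (s / INR k)) (INR k * sin (s / INR k)) = trig_sum a b s.
Proof.
  intros Hk Ha Hb. assert (HK : 0 < INR k) by (apply lt_0_INR; lia).
  unfold extension, trig_sum, fsum.
  rewrite <- Series_plus.
  - apply Series_ext; intros n.
    rewrite cos_mode_polar, sin_mode_polar.
    replace (INR k / INR k) with 1 by (field; lra).
    rewrite cutoff_eq_1 by lra. rewrite pow1, mult_INR.
    replace (INR k * INR n * (s / INR k)) with (INR n * s) by (field; lra). ring.
  - apply ex_series_fsum; [easy | apply (collared_tame k Hk), collared_cos_mode].
  - apply ex_series_fsum; [easy | apply (collared_tame k Hk), collared_sin_mode].
Qed.

(** By uniqueness of derivatives, [c n] is the gradient of the [n]-th term applied to the radial
    direction. Hence the series is differentiated through the gradient of [fsum], without a separate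
    convergence argument along the ray. *)
Lemma fsum_normal_derivative (k : nat) (a : nat -> R) (H : nat -> R -> R -> R) (phi : R) (c : nat -> R) :
  (1 <= k)%nat -> rapid a -> collared k H ->
  (forall n, is_derive (fun t => H n ((INR k + t) * cos phi) ((INR k + t) * sin phi)) 0 (c n)) ->
  is_derive (fun t => fsum a H ((INR k + t) * cos phi) ((INR k + t) * sin phi)) 0
    (Series (fun n => a n * c n)) /\ ex_series (fun n => a n * c n).
Proof.
  intros Hk Ha TH Dn. assert (HT := collared_tame k Hk).
  destruct (proj2 HT H TH) as [Hx [Hy [Tx [Ty G]]]].
  assert (GF : has_grad (fsum a H) (fsum a Hx) (fsum a Hy)).
  { apply differentiable_has_grad. now apply (fsum_differentiable (collared k)). }
  set (X := fun t => (INR k + t) * cos phi). set (Y := fun t => (INR k + t) * sin phi).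
  assert (DX : is_derive X 0 (cos phi)) by (unfold X; auto_derive; [easy | ring]).
  assert (DY : is_derive Y 0 (sin phi)) by (unfold Y; auto_derive; [easy | ring]).
  assert (Ec : forall n, c n = Hx n (X 0) (Y 0) * cos phi + Hy n (X 0) (Y 0) * sin phi).
  { intros n. rewrite <- (is_derive_unique _ _ _ (Dn n)). apply is_derive_unique.
    apply (G n X Y 0 _ _ DX DY). }
  assert (Sx : ex_series (fun n => cos phi * (a n * Hx n (X 0) (Y 0)))).
  { apply (ex_series_scal (V := R_NormedModule)), ex_series_fsum; [easy | now apply HT]. }
  assert (Sy : ex_series (fun n => sin phi * (a n * Hy n (X 0) (Y 0)))).
  { apply (ex_series_scal (V := R_NormedModule)), ex_series_fsum; [easy | now apply HT]. }
  assert (Ee : forall n, cos phi * (a n * Hx n (X 0) (Y 0)) + sin phi * (a n * Hy n (X 0) (Y 0))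
             = a n * c n) by (intros n; rewrite Ec; ring).
  split.
  - replace (Series (fun n => a n * c n))
      with (fsum a Hx (X 0) (Y 0) * cos phi + fsum a Hy (X 0) (Y 0) * sin phi).
    + apply (GF X Y 0 _ _ DX DY).
    + unfold fsum. rewrite (Rmult_comm _ (cos phi)), (Rmult_comm _ (sin phi)), <- !Series_scal_l.
      rewrite <- Series_plus by easy. apply Series_ext, Ee.
  - apply ex_series_ext with (1 := Ee).
    now apply (ex_series_plus (V := R_NormedModule)).
Qed.

Lemma extension_normal_derivative (k : nat) (a b : nat -> R) (s : R) :
  (1 <= k)%nat -> rapid a -> rapid b ->
  is_derive (fun t => extension k a b ((INR k + t) * cos (s / INR k)) ((INR k + t) * sin (s / INR k)))
    0 (trig_sum (fun n => INR n * a n) (fun n => INR n * b n) s).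
Proof.
  intros Hk Ha Hb. assert (HK : 0 < INR k) by (apply lt_0_INR; lia).
  destruct (fsum_normal_derivative k a (cos_mode k) (s / INR k) (fun n => INR n * cos (INR n * s))
    Hk Ha (collared_cos_mode k)) as [Dc Ec].
  { intros n.
    apply is_derive_ext with (2 := is_derive_radial_factor k n (cos (INR n * s)) Hk).
    intros t; rewrite cos_mode_polar, mult_INR.
    now replace (INR k * INR n * (s / INR k)) with (INR n * s) by (field; lra). }
  destruct (fsum_normal_derivative k b (sin_mode k) (s / INR k) (fun n => INR n * sin (INR n * s))
    Hk Hb (collared_sin_mode k)) as [Ds Es].
  { intros n.
    apply is_derive_ext with (2 := is_derive_radial_factor k n (sin (INR n * s)) Hk).
    intros t; rewrite sin_mode_polar, mult_INR.
    now replace (INR k * INR n * (s / INR k)) with (INR n * s) by (field; lra). }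
  replace (trig_sum _ _ s) with (Series (fun n => a n * (INR n * cos (INR n * s)))
     + Series (fun n => b n * (INR n * sin (INR n * s)))).
  - now apply (is_derive_plus (fun t => fsum a (cos_mode k) _ _) (fun t => fsum b (sin_mode k) _ _)).
  - unfold trig_sum. rewrite <- Series_plus by easy. apply Series_ext; intros n; ring.
Qed.

(** * Invariance under the rotations *)

Lemma cos_sin_IZR_period (j : Z) :
  cos (IZR j * (2 * PI)) = 1 /\ sin (IZR j * (2 * PI)) = 0.
Proof.
  assert (P : forall n : nat, cos (INR n * (2 * PI)) = 1 /\ sin (INR n * (2 * PI)) = 0).
  { intros n. generalize (cos_period 0 n) (sin_period 0 n).
    rewrite cos_0, sin_0, Rplus_0_l.
    now replace (2 * INR n * PI) with (INR n * (2 * PI)) by ring. }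
  destruct (Z.abs_eq_or_opp j) as [E | E].
  - rewrite <- E, <- Zabs2Nat.id_abs, <- INR_IZR_INZ. apply P.
  - replace (IZR j) with (- INR (Z.abs_nat j)).
    + replace (- INR (Z.abs_nat j) * (2 * PI)) with (- (INR (Z.abs_nat j) * (2 * PI))) by ring.
      rewrite cos_neg, sin_neg. destruct (P (Z.abs_nat j)) as [-> ->]; lra.
    + rewrite INR_IZR_INZ, Zabs2Nat.id_abs, E, opp_IZR; ring.
Qed.

(** Only exponents kn occur, and kn times the angle 2 PI j / k is a multiple of 2 PI; the collar
    depends only on the distance to the origin. *)
Lemma extension_rot (k : nat) (a b : nat -> R) (j : Z) (p : R * R) :
  (1 <= k)%nat ->
  extension k a b (fst (rot (IZR j * (2 * PI / INR k)) p)) (snd (rot (IZR j * (2 * PI / INR k)) p))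
    = extension k a b (fst p) (snd p).
Proof.
  intros Hk. assert (HK : 0 < INR k) by (apply lt_0_INR; lia).
  destruct p as [x y]; unfold rot; simpl fst; simpl snd.
  set (t := IZR j * (2 * PI / INR k)).
  assert (T : forall n, cos (INR (k * n) * t) = 1 /\ sin (INR (k * n) * t) = 0).
  { intros n. replace (INR (k * n) * t) with (IZR (Z.of_nat n * j) * (2 * PI)).
    - apply cos_sin_IZR_period.
    - unfold t. rewrite mult_IZR, mult_INR, <- INR_IZR_INZ. field; lra. }
  assert (C : forall n, collar k n (cos t * x - sin t * y) (sin t * x + cos t * y) = collar k n x y).
  { intros n. unfold collar. f_equal.
    transitivity ((sin t * sin t + cos t * cos t) * ((x / INR k) ^ 2 + (y / INR k) ^ 2) - 1);
      [unfold Rdiv; ring |].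
    generalize (sin2_cos2 t); unfold Rsqr; intros ->; ring. }
  assert (E : forall n : nat, (cos t * x - sin t * y) / INR k = cos t * (x / INR k) - sin t * (y / INR k)
     /\ (sin t * x + cos t * y) / INR k = sin t * (x / INR k) + cos t * (y / INR k))
    by (intros n; unfold Rdiv; split; ring).
  unfold extension, fsum; f_equal; apply Series_ext; intros n; f_equal.
  - unfold cos_mode. rewrite C, (proj1 (E n)), (proj2 (E n)), (proj1 (zpow_rot _ _ _ _)).
    destruct (T n) as [-> ->]; ring.
  - unfold sin_mode. rewrite C, (proj1 (E n)), (proj2 (E n)), (proj2 (zpow_rot _ _ _ _)).
    destruct (T n) as [-> ->]; ring.
Qed.

(** * Smoothness of trigonometric series *)

Definition trig_class (H : nat -> R -> R -> R) : Prop :=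
  exists a b : nat -> R,
    (exists C p, forall n, Rabs (a n) <= C * (INR n + 1) ^ p) /\
    (exists C p, forall n, Rabs (b n) <= C * (INR n + 1) ^ p) /\
    H = fun n x _ => a n * cos (INR n * x) + b n * sin (INR n * x).

(** The members are constant in the second variable. Placing them in the plane lets the results on
    tame classes give smooth functions on the circle, as is required of the values of the
    Dirichlet-to-Neumann operator. *)
Lemma trig_class_tame : tame_class trig_class.
Proof.
  assert (Sc : forall (c : R) (a : nat -> R), Rabs c <= 1 ->
     (exists C p, forall n, Rabs (a n) <= C * (INR n + 1) ^ p) ->
     exists C p, forall n, Rabs (c * (INR n * a n)) <= C * (INR n + 1) ^ p).
  { intros c a Hc [C [p B]]; exists C, (S p); intros n.
    rewrite !Rabs_mult, (Rabs_right (INR n)) by (apply Rle_ge, pos_INR).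
    rewrite <- tech_pow_Rmult. specialize (B n).
    generalize (pos_INR n) (Rabs_pos (a n)) (Rabs_pos c); intros.
    apply Rle_trans with (1 * (INR n * Rabs (a n))); [apply Rmult_le_compat_r; nra | nra]. }
  split.
  - intros H (a & b & (C & p & Ba) & (D & q & Bb) & ->).
    exists (Rabs C + Rabs D), (p + q)%nat; intros n x _.
    assert (Hn := INR_succ_ge_1 n).
    assert (W : forall C p c u, (forall n, Rabs (c n) <= C * (INR n + 1) ^ p) -> Rabs u <= 1 ->
       forall N, (p <= N)%nat -> Rabs (c n * u) <= Rabs C * (INR n + 1) ^ N).
    { clear - Hn; intros C p c u B Hu N HN. rewrite Rabs_mult.
      apply Rle_trans with (Rabs (c n) * 1);
        [apply Rmult_le_compat_l; [apply Rabs_pos | easy] | rewrite Rmult_1_r].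
      eapply Rle_trans; [apply B |].
      apply Rle_trans with (Rabs C * (INR n + 1) ^ p).
      - apply Rmult_le_compat_r; [apply pow_le; lra | apply Rle_abs].
      - apply Rmult_le_compat_l; [apply Rabs_pos | now apply Rle_pow]. }
    eapply Rle_trans; [apply Rabs_triang |]. rewrite Rmult_plus_distr_r.
    apply Rplus_le_compat.
    + apply (W C p); [easy | apply Rabs_le, COS_bound | lia].
    + apply (W D q); [easy | apply Rabs_le, SIN_bound | lia].
  - intros H (a & b & Ba & Bb & ->).
    exists (fun n x _ => (1 * (INR n * b n)) * cos (INR n * x) + (-1 * (INR n * a n)) * sin (INR n * x)),
      (fun n x _ => 0 * cos (INR n * x) + 0 * sin (INR n * x)).
    assert (Z : exists C p, forall n : nat, Rabs 0 <= C * (INR n + 1) ^ p).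
    { exists 0, O; intros; rewrite Rabs_R0; lra. }
    split; [| split].
    + exists (fun n => 1 * (INR n * b n)), (fun n => -1 * (INR n * a n)).
      split; [| split; [| easy]]; apply Sc; try easy.
      * rewrite Rabs_R1; lra.
      * rewrite Rabs_left; lra.
    + exists (fun _ => 0), (fun _ => 0). easy.
    + intros n.
      assert (P : forall s, is_derive (fun s => a n * cos (INR n * s) + b n * sin (INR n * s)) s
        ((1 * (INR n * b n)) * cos (INR n * s) + (-1 * (INR n * a n)) * sin (INR n * s))).
      { intros s; auto_derive; [easy | ring]. }
      apply (has_grad_ext _ _ _ _ _ _ (has_grad_comp _ _ _ _ _ P has_grad_fst));
        intros x y; try easy; ring.
Qed.

Lemma ex_derive_n_of_smooth2 (F : R -> R -> R) (n : nat) (s : R) :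
  smooth2 F -> ex_derive_n (fun x => F x 0) n s.
Proof.
  revert F s; induction n as [| n IH]; intros F s HF; [exact I |].
  assert (HD : smooth2 (fun u v => Derive (fun z => F z v) u)).
  { intros m x y. apply (HF (S m) x y). }
  destruct n as [| n].
  - apply (HF 1%nat s 0).
  - generalize (IH _ s HD). simpl.
    apply ex_derive_ext. intros t.
    change (Derive_n (Derive_n (fun x => F x 0) 1) n t = Derive_n (fun x => F x 0) (S n) t).
    now rewrite Derive_n_comp, Nat.add_1_r.
Qed.

Lemma trig_sum_smooth (a b : nat -> R) (n : nat) (s : R) :
  rapid a -> rapid b -> ex_derive_n (trig_sum a b) n s.
Proof.
  intros Ha Hb.
  assert (Bd : forall c : R, Rabs c <= 1 -> exists C p, forall n : nat, Rabs c <= C * (INR n + 1) ^ p).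
  { intros c Hc; exists 1, O; intros; simpl; lra. }
  assert (B0 : Rabs 0 <= 1) by (rewrite Rabs_R0; lra).
  assert (B1 : Rabs 1 <= 1) by (rewrite Rabs_R1; lra).
  set (H := fun (n : nat) (x _ : R) => 1 * cos (INR n * x) + 0 * sin (INR n * x)).
  set (K := fun (n : nat) (x _ : R) => 0 * cos (INR n * x) + 1 * sin (INR n * x)).
  assert (TH : trig_class H).
  { exists (fun _ => 1), (fun _ => 0). split; [| split]; auto. }
  assert (TK : trig_class K).
  { exists (fun _ => 0), (fun _ => 1). split; [| split]; auto. }
  apply ex_derive_n_ext with (fun x => fsum a H x 0 + fsum b K x 0).
  - intros t. unfold fsum, trig_sum. rewrite <- Series_plus.
    + apply Series_ext; intros m; unfold H, K; ring.
    + apply ex_series_fsum; [easy | now apply trig_class_tame].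
    + apply ex_series_fsum; [easy | now apply trig_class_tame].
  - apply (ex_derive_n_of_smooth2 (fun x y => fsum a H x y + fsum b K x y)).
    now apply (fsum_smooth2 trig_class); try apply trig_class_tame.
Qed.

Lemma trig_sum_periodic (a b : nat -> R) (s : R) :
  trig_sum a b (s + 2 * PI) = trig_sum a b s.
Proof.
  unfold trig_sum; apply Series_ext; intros n.
  replace (INR n * (s + 2 * PI)) with (INR n * s + 2 * INR n * PI) by ring.
  now rewrite cos_period, sin_period.
Qed.

(** * Uniqueness of the harmonic extension *)

(** Iterated maxima in one variable. The maximizer [Y x] is picked by choice and need not depend
    continuously on [x], but the maximum [f x (Y x)] does, by uniform continuity of [f]. *)
Lemma rectangle_maximum (f : R -> R -> R) (a b c d : R) :
  a <= b -> c <= d -> (forall x y, continuity_2d_pt f x y) ->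
  exists x0 y0, a <= x0 <= b /\ c <= y0 <= d /\
    forall x y, a <= x <= b -> c <= y <= d -> f x y <= f x0 y0.
Proof.
  intros Hab Hcd Cf.
  assert (M : forall x, exists y0, (forall y, c <= y <= d -> f x y <= f x y0) /\ c <= y0 <= d).
  { intros x. apply continuity_ab_maj; [easy |]. intros y _ .
    apply continuity_pt_locally; intros eps.
    destruct (Cf x y eps) as [del H]. exists del; intros v Hv.
    apply H; [rewrite Rminus_diag, Rabs_R0; apply cond_pos | exact Hv]. }
  set (Y := fun x => proj1_sig (constructive_indefinite_description _ (M x))).
  assert (HY : forall x, (forall y, c <= y <= d -> f x y <= f x (Y x)) /\ c <= Y x <= d)
    by (intros x; exact (proj2_sig (constructive_indefinite_description _ (M x)))).
  destruct (continuity_ab_maj (fun x => f x (Y x)) a b Hab) as [x0 [H1 H2]].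
  - intros x _. apply continuity_pt_locally; intros eps.
    (* Uniform continuity is taken on a compact rectangle around [x], hence the window of half-width
       1 and the minimum with 1 below. *)
    destruct (uniform_continuity_2d f (x - 1) (x + 1) c d (fun x y _ _ => Cf x y) eps) as [del H].
    assert (Hd : 0 < Rmin del 1) by (apply Rmin_pos; [apply cond_pos | lra]).
    exists (mkposreal _ Hd); intros u Hu.
    unfold ball in Hu; simpl in Hu; unfold AbsRing_ball, abs, minus, plus, opp in Hu; simpl in Hu.
    assert (Hu1 := Rlt_le_trans _ _ _ Hu (Rmin_l _ _)).
    assert (Hu2 := Rlt_le_trans _ _ _ Hu (Rmin_r _ _)).
    apply Rabs_def2 in Hu2.
    destruct (HY x) as [X1 X2]. destruct (HY u) as [U1 U2].
    assert (Z : forall y, Rabs (y - y) < del)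
      by (intros; rewrite Rminus_diag, Rabs_R0; apply cond_pos).
    assert (A1 : Rabs (f u (Y x) - f x (Y x)) < eps) by (apply H; try lra; easy).
    assert (A2 : Rabs (f u (Y u) - f x (Y u)) < eps) by (apply H; try lra; easy).
    apply Rabs_def2 in A1; apply Rabs_def2 in A2.
    generalize (X1 _ U2) (U1 _ X2). intros. apply Rabs_def1; lra.
  - exists x0, (Y x0). split; [easy | split; [apply HY |]].
    intros x y Hx Hy. apply Rle_trans with (f x (Y x)); [now apply HY | now apply H1].
Qed.

Lemma disk_maximum (f : R -> R -> R) (r : R) :
  0 <= r -> (forall x y, continuity_2d_pt f x y) ->
  exists x0 y0, x0 ^ 2 + y0 ^ 2 <= r ^ 2 /\
    forall x y, x ^ 2 + y ^ 2 <= r ^ 2 -> f x y <= f x0 y0.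
Proof.
  intros Hr Cf.
  (* [(x, t) |-> (x, t sqrt(r^2 - x^2))] maps a rectangle onto the disk. *)
  set (g := fun x t => f x (t * sqrt (r ^ 2 - x ^ 2))).
  (* [sqrt] is 0 on negative numbers, so it is continuous on the whole line and [g] on the whole
     plane. *)
  assert (Cs : forall x t, continuity_2d_pt (fun x t => t * sqrt (r ^ 2 - x ^ 2)) x t).
  { intros x t. apply continuity_2d_pt_mult; [apply continuity_2d_pt_id2 |].
    apply (continuity_1d_2d_pt_comp (fun x => sqrt (r ^ 2 - x ^ 2)) (fun x _ => x));
      [| apply continuity_2d_pt_id1].
    apply continuity_pt_filterlim.
    apply (continuous_comp (fun x => r ^ 2 - x ^ 2) sqrt); [| apply continuous_sqrt].
    apply (ex_derive_continuous (V := R_NormedModule)). auto_derive; easy. }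
  destruct (rectangle_maximum g (- r) r (-1) 1) as (x0 & t0 & Hx0 & Ht0 & HM); try lra.
  - intros x t eps.
    destruct (Cf x (t * sqrt (r ^ 2 - x ^ 2)) eps) as [del Hdel].
    destruct (Cs x t del) as [del' Hdel'].
    assert (Hd : 0 < Rmin del del') by (apply Rmin_pos; apply cond_pos).
    exists (mkposreal _ Hd); simpl; intros u v Hu Hv. apply Hdel.
    + eapply Rlt_le_trans; [apply Hu | apply Rmin_l].
    + apply Hdel'; (eapply Rlt_le_trans; [eassumption | apply Rmin_r]).
  - exists x0, (t0 * sqrt (r ^ 2 - x0 ^ 2)). split.
    + rewrite Rpow_mult_distr, pow2_sqrt by nra.
      assert (0 <= r ^ 2 - x0 ^ 2) by nra. assert (t0 ^ 2 <= 1) by nra. nra.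
    + intros x y Hxy.
      assert (Hx : - r <= x <= r) by (split; nra).
      destruct (Rle_lt_or_eq_dec (x ^ 2) (r ^ 2)) as [Hlt | Heq]; [nra | |].
      * assert (P : 0 < sqrt (r ^ 2 - x ^ 2)) by (apply sqrt_lt_R0; lra).
        assert (P2 := pow2_sqrt (r ^ 2 - x ^ 2) ltac:(lra)).
        replace y with (y / sqrt (r ^ 2 - x ^ 2) * sqrt (r ^ 2 - x ^ 2)) by (field; lra).
        apply HM; [easy |].
        set (s := sqrt _) in *. assert (Hy : y ^ 2 <= s ^ 2) by lra.
        assert (- s <= y <= s) by (split; nra).
        split; apply Rmult_le_reg_r with s; try easy; field_simplify; lra.
      (* At [x = r] and [x = - r] the vertical chord is a single point, reached with [t = 0]. *)
      * replace y with (0 * sqrt (r ^ 2 - x ^ 2)) by nra. apply HM; lra.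
Qed.

(** If [l] were positive, [f1] would vanish at [x0] and be positive just to the right of it, so [f]
    would increase past its maximum. *)
Lemma local_max_second_derivative (f f1 : R -> R) (x0 l d : R) :
  (forall x, is_derive f x (f1 x)) -> is_derive f1 x0 l -> 0 < d ->
  (forall x, Rabs (x - x0) < d -> f x <= f x0) -> l <= 0.
Proof.
  intros Df Df1 Hd Hm. apply Rnot_lt_le; intros Hl.
  assert (Z : f1 x0 = 0).
  { assert (D : derivable_pt_lim f x0 (f1 x0)) by now apply is_derive_Reals.
    set (pr := exist _ (f1 x0) D : derivable_pt f x0).
    change (derive_pt f x0 pr = 0).
    apply (deriv_maximum f (x0 - d) (x0 + d)); try lra.
    intros x H1 H2. apply Hm, Rabs_def1; lra. }
  apply is_derive_Reals in Df1.
  destruct (Df1 (l / 2)) as [del Hdel]; [lra |].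
  set (h := Rmin (del / 2) (d / 2)).
  assert (Hdp := cond_pos del).
  assert (Hh : 0 < h) by (apply Rmin_pos; lra).
  assert (Hh1 : h <= del / 2) by apply Rmin_l.
  assert (Hh2 : h <= d / 2) by apply Rmin_r.
  destruct (MVT_cor2 f f1 x0 (x0 + h)) as [c [Ec Hc]]; [lra | |].
  { intros; now apply is_derive_Reals. }
  assert (F : f (x0 + h) <= f x0) by (apply Hm; rewrite Rabs_right; lra).
  specialize (Hdel (c - x0) ltac:(lra) ltac:(rewrite Rabs_right; lra)).
  replace (x0 + (c - x0)) with c in Hdel by ring. rewrite Z, Rminus_0_r in Hdel.
  apply Rabs_def2 in Hdel.
  assert (0 < f1 c).
  { assert (P : 0 < f1 c / (c - x0)) by lra.
    apply (Rmult_lt_compat_r (c - x0)) in P; [| lra]. field_simplify in P; lra. }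
  nra.
Qed.

(** Adding e (x^2 + y^2) makes the Laplacian equal to 4e > 0 in the open disk, which excludes an
    interior maximum. *)
Lemma weak_maximum_principle (f fx fy fxx fyy : R -> R -> R) (r : R) :
  0 < r -> (forall x y, continuity_2d_pt f x y) ->
  (forall x y, is_derive (fun t => f t y) x (fx x y)) ->
  (forall x y, is_derive (fun t => fx t y) x (fxx x y)) ->
  (forall x y, is_derive (fun t => f x t) y (fy x y)) ->
  (forall x y, is_derive (fun t => fy x t) y (fyy x y)) ->
  (forall x y, x ^ 2 + y ^ 2 < r ^ 2 -> fxx x y + fyy x y = 0) ->
  (forall x y, x ^ 2 + y ^ 2 = r ^ 2 -> f x y <= 0) ->
  forall x y, x ^ 2 + y ^ 2 <= r ^ 2 -> f x y <= 0.
Proof.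
  intros Hr Cf Dx Dxx Dy Dyy L B x1 y1 H1. apply Rnot_lt_le; intros Hpos.
  (* With this [e], the perturbed function on the circle is at most e r^2 = f(x1, y1)/2, below its
     value at (x1, y1), so its maximum is not on the circle. *)
  set (e := f x1 y1 / (2 * r ^ 2)).
  assert (Hr2 : 0 < r ^ 2) by now apply pow_lt.
  assert (He : 0 < e) by (apply Rdiv_lt_0_compat; lra).
  assert (Her : e * r ^ 2 = f x1 y1 / 2) by (unfold e; field; lra).
  set (g := fun x y => f x y + e * (x ^ 2 + y ^ 2)).
  destruct (disk_maximum g r) as (x0 & y0 & H0 & M); [lra | |].
  { intros x y. apply continuity_2d_pt_plus; [apply Cf |].
    apply continuity_2d_pt_mult; [apply continuity_2d_pt_const |].
    apply continuity_2d_pt_plus.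
    - apply (continuity_1d_2d_pt_comp (fun x => x ^ 2) (fun x _ => x)); [| apply continuity_2d_pt_id1].
      apply derivable_continuous_pt; auto with real. apply derivable_pt_pow.
    - apply (continuity_1d_2d_pt_comp (fun x => x ^ 2) (fun _ y => y)); [| apply continuity_2d_pt_id2].
      apply derivable_continuous_pt; auto with real. apply derivable_pt_pow. }
  assert (In : x0 ^ 2 + y0 ^ 2 < r ^ 2).
  { destruct (Rle_lt_or_eq_dec _ _ H0) as [| E]; [easy | exfalso].
    generalize (M x1 y1 H1) (B x0 y0 E). unfold g. rewrite E.
    assert (0 <= e * (x1 ^ 2 + y1 ^ 2))
      by (apply Rmult_le_pos; [lra | generalize (pow2_ge_0 x1) (pow2_ge_0 y1); lra]).
    lra. }
  assert (Nb : forall u v, u ^ 2 + v ^ 2 < r ^ 2 -> exists d, 0 < d /\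
            forall t, Rabs (t - u) < d -> t ^ 2 + v ^ 2 <= r ^ 2).
  { intros u v Huv. set (q := r ^ 2 - (u ^ 2 + v ^ 2)).
    assert (Hq : 0 < q) by (unfold q; lra).
    (* For |t - u| < 1 the increase t^2 - u^2 is at most |t - u| (2 |u| + 1), to be kept below the
       room [q] left in the disk. *)
    exists (Rmin 1 (q / (2 * Rabs u + 1))). generalize (Rabs_pos u); intros Au. split.
    - apply Rmin_pos; [lra | apply Rdiv_lt_0_compat; lra].
    - intros t Ht.
      assert (T1 := Rlt_le_trans _ _ _ Ht (Rmin_l _ _)).
      assert (T2 := Rlt_le_trans _ _ _ Ht (Rmin_r _ _)).
      apply (Rmult_lt_compat_r (2 * Rabs u + 1)) in T2; [| lra].
      replace (q / (2 * Rabs u + 1) * (2 * Rabs u + 1)) with q in T2 by (field; lra).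
      assert (E : t ^ 2 - u ^ 2 <= Rabs (t - u) * (2 * Rabs u + 1)).
      { replace (t ^ 2 - u ^ 2) with ((t - u) * (t - u + 2 * u)) by ring.
        eapply Rle_trans; [apply Rle_abs |]. rewrite Rabs_mult.
        apply Rmult_le_compat_l; [apply Rabs_pos |].
        eapply Rle_trans; [apply Rabs_triang |]. rewrite Rabs_mult, (Rabs_right 2); lra. }
      unfold q in T2; lra. }
  assert (Gx : fxx x0 y0 + 2 * e <= 0).
  { destruct (Nb x0 y0 In) as [d [Hd Nd]].
    apply (local_max_second_derivative (fun t => g t y0) (fun t => fx t y0 + e * (2 * t)) x0 _ d);
      [| | easy |].
    - intros t. apply (is_derive_plus (fun t => f t y0) (fun t => e * (t ^ 2 + y0 ^ 2)));
        [apply Dx | auto_derive; [easy | ring]].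
    - apply (is_derive_plus (fun t => fx t y0) (fun t => e * (2 * t)));
        [apply Dxx | auto_derive; [easy | ring]].
    - intros t Ht. apply M, Nd, Ht. }
  assert (Gy : fyy x0 y0 + 2 * e <= 0).
  { destruct (Nb y0 x0) as [d [Hd Nd]]; [lra |].
    apply (local_max_second_derivative (fun t => g x0 t) (fun t => fy x0 t + e * (2 * t)) y0 _ d);
      [| | easy |].
    - intros t. apply (is_derive_plus (fun t => f x0 t) (fun t => e * (x0 ^ 2 + t ^ 2)));
        [apply Dy | auto_derive; [easy | ring]].
    - apply (is_derive_plus (fun t => fy x0 t) (fun t => e * (2 * t)));
        [apply Dyy | auto_derive; [easy | ring]].
    - intros t Ht. apply M. specialize (Nd t Ht). lra. }
  generalize (L x0 y0 In); lra.
Qed.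

Lemma circle_polar (x y r : R) :
  0 < r -> x ^ 2 + y ^ 2 = r ^ 2 -> exists t, x = r * cos t /\ y = r * sin t.
Proof.
  intros Hr H.
  assert (E : (x / r) ^ 2 + (y / r) ^ 2 = 1).
  { replace ((x / r) ^ 2 + (y / r) ^ 2) with ((x ^ 2 + y ^ 2) / r ^ 2) by (field; lra).
    rewrite H; field; lra. }
  assert (Bx : -1 <= x / r <= 1) by (generalize (pow2_ge_0 (y / r)); split; nra).
  assert (C := cos_acos _ Bx). set (t := acos (x / r)) in *.
  assert (S2 : sin t * sin t = (y / r) * (y / r)).
  { generalize (sin2_cos2 t); unfold Rsqr; rewrite C; lra. }
  assert (S : y / r = sin t \/ y / r = - sin t).
  { assert (Z : (y / r - sin t) * (y / r + sin t) = 0) by lra.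
    apply Rmult_integral in Z. destruct Z; [left | right]; lra. }
  destruct S as [S | S]; [exists t | exists (- t)]; rewrite ?cos_neg, ?sin_neg, C, <- S; split; field; lra.
Qed.

Lemma smooth2_second_derivatives (F : R -> R -> R) : smooth2 F ->
  exists fx fy fxx fyy : R -> R -> R,
    (forall x y, continuity_2d_pt F x y) /\
    (forall x y, is_derive (fun t => F t y) x (fx x y)) /\
    (forall x y, is_derive (fun t => fx t y) x (fxx x y)) /\
    (forall x y, is_derive (fun t => F x t) y (fy x y)) /\
    (forall x y, is_derive (fun t => fy x t) y (fyy x y)) /\
    (forall x y, laplacian F x y = fxx x y + fyy x y).
Proof.
  intros HF.
  exists (fun x y => Derive (fun t => F t y) x), (fun x y => Derive (fun t => F x t) y),
    (fun x y => Derive (fun t => Derive (fun t => F t y) t) x),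
    (fun x y => Derive (fun t => Derive (fun t => F x t) t) y).
  split; [| split; [| split; [| split; [| split]]]]; try intros x y.
  - apply (HF O x y).
  - apply Derive_correct. apply (HF 1%nat x y).
  - apply Derive_correct. apply (HF 2%nat x y).
  - apply Derive_correct. apply (HF 1%nat x y).
  - apply Derive_correct. apply (HF 2%nat x y).
  - reflexivity.
Qed.

Lemma harmonic_uniqueness (F G : R -> R -> R) (r : R) :
  0 < r -> smooth2 F -> smooth2 G ->
  (forall x y, x ^ 2 + y ^ 2 < r ^ 2 -> laplacian F x y = 0) ->
  (forall x y, x ^ 2 + y ^ 2 < r ^ 2 -> laplacian G x y = 0) ->
  (forall x y, x ^ 2 + y ^ 2 = r ^ 2 -> F x y = G x y) ->
  forall x y, x ^ 2 + y ^ 2 <= r ^ 2 -> F x y = G x y.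
Proof.
  intros Hr SF SG LF LG B x y H.
  assert (W : forall F G : R -> R -> R, smooth2 F -> smooth2 G ->
    (forall x y, x ^ 2 + y ^ 2 < r ^ 2 -> laplacian F x y = 0) ->
    (forall x y, x ^ 2 + y ^ 2 < r ^ 2 -> laplacian G x y = 0) ->
    (forall x y, x ^ 2 + y ^ 2 = r ^ 2 -> F x y = G x y) ->
    forall x y, x ^ 2 + y ^ 2 <= r ^ 2 -> F x y <= G x y).
  { clear - Hr. intros F G SF SG LF LG B x y H.
    destruct (smooth2_second_derivatives F SF) as (fx & fy & fxx & fyy & Cf & Dx & Dxx & Dy & Dyy & Lf).
    destruct (smooth2_second_derivatives G SG) as (gx & gy & gxx & gyy & Cg & Ex & Exx & Ey & Eyy & Lg).
    apply Rminus_le.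
    apply (weak_maximum_principle (fun x y => F x y - G x y) (fun x y => fx x y - gx x y)
      (fun x y => fy x y - gy x y) (fun x y => fxx x y - gxx x y) (fun x y => fyy x y - gyy x y) r Hr);
      try easy; intros u v.
    - now apply continuity_2d_pt_minus.
    - apply (is_derive_minus (fun t => F t v) (fun t => G t v)); easy.
    - apply (is_derive_minus (fun t => fx t v) (fun t => gx t v)); easy.
    - apply (is_derive_minus (fun t => F u t) (fun t => G u t)); easy.
    - apply (is_derive_minus (fun t => fy u t) (fun t => gy u t)); easy.
    - intros Huv. generalize (LF u v Huv) (LG u v Huv). rewrite Lf, Lg; lra.
    - intros Huv. rewrite (B u v Huv); lra. }
  apply Rle_antisym; apply W; try easy. intros; symmetry; now apply B.
Qed.

(** * Fourier series of smooth periodic functions *)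

(** Continuity is asked on one closed period only, because the quotient by sin (t/2) in the
    convergence proof is controlled only there. *)
Definition continuous_period (f : R -> R) : Prop :=
  forall x, - PI <= x <= PI -> continuous f x.

Definition period_int (f : R -> R) : R := RInt f (- PI) PI.

Lemma ex_period_int (f : R -> R) : continuous_period f -> ex_RInt f (- PI) PI.
Proof.
  intros H; apply (ex_RInt_continuous (V := R_CompleteNormedModule)).
  assert (P := PI_RGT_0). intros z Hz; rewrite Rmin_left, Rmax_right in Hz by lra. now apply H.
Qed.

Lemma continuous_period_plus (f g : R -> R) :
  continuous_period f -> continuous_period g -> continuous_period (fun x => f x + g x).
Proof. intros Hf Hg x Hx. apply (continuous_plus f g); auto. Qed.

Lemma continuous_period_mult (f g : R -> R) :
  continuous_period f -> continuous_period g -> continuous_period (fun x => f x * g x).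
Proof. intros Hf Hg x Hx. apply (continuous_mult f g); auto. Qed.

Lemma continuous_period_scal (c : R) (f : R -> R) :
  continuous_period f -> continuous_period (fun x => c * f x).
Proof. intros Hf x Hx. apply (continuous_scal_r c f); auto. Qed.

Lemma continuous_period_derive (f df : R -> R) :
  (forall x, is_derive f x (df x)) -> continuous_period f.
Proof.
  intros H x _. apply (ex_derive_continuous (V := R_NormedModule)). now exists (df x).
Qed.

Lemma period_int_plus (f g : R -> R) :
  continuous_period f -> continuous_period g ->
  period_int (fun x => f x + g x) = period_int f + period_int g.
Proof. intros Hf Hg; apply (RInt_plus f g); now apply ex_period_int. Qed.

Lemma period_int_scal (c : R) (f : R -> R) :
  continuous_period f -> period_int (fun x => c * f x) = c * period_int f.
Proof. intros Hf; apply (RInt_scal f); now apply ex_period_int. Qed.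

Lemma period_int_ext (f g : R -> R) :
  (forall x, - PI <= x <= PI -> f x = g x) -> period_int f = period_int g.
Proof.
  intros H; apply RInt_ext. assert (P := PI_RGT_0).
  intros x Hx; rewrite Rmin_left, Rmax_right in Hx by lra. apply H; lra.
Qed.

Lemma period_int_const (c : R) : period_int (fun _ => c) = 2 * PI * c.
Proof.
  unfold period_int; rewrite RInt_const; unfold scal; simpl; unfold mult; simpl; ring.
Qed.

Lemma period_int_derive (f df : R -> R) :
  (forall x, is_derive f x (df x)) -> continuous_period df -> period_int df = f PI - f (- PI).
Proof.
  intros D C; apply is_RInt_unique.
  assert (P := PI_RGT_0).
  apply (is_RInt_derive f df); [intros; apply D |].
  intros x Hx; rewrite Rmin_left, Rmax_right in Hx by lra. now apply C.
Qed.

Lemma period_int_ge_0 (f : R -> R) :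
  continuous_period f -> (forall x, 0 <= f x) -> 0 <= period_int f.
Proof.
  intros C H. assert (P := PI_RGT_0).
  apply RInt_ge_0; [lra | now apply ex_period_int | easy].
Qed.

(** * Orthogonality and the Riemann-Lebesgue lemma *)

Lemma continuous_sin_lin (c : R) : continuous_period (fun t => sin (c * t)).
Proof.
  apply continuous_period_derive with (fun t => c * cos (c * t)).
  intros; auto_derive; [easy | ring].
Qed.

Lemma continuous_cos_lin (c : R) : continuous_period (fun t => cos (c * t)).
Proof.
  apply continuous_period_derive with (fun t => - (c * sin (c * t))).
  intros; auto_derive; [easy | ring].
Qed.

Lemma sin_INR_PI (n : nat) : sin (INR n * PI) = 0.
Proof.
  apply sin_eq_0_1. exists (Z.of_nat n). now rewrite <- INR_IZR_INZ.
Qed.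

Lemma period_int_cos (n : nat) : n <> O -> period_int (fun t => cos (INR n * t)) = 0.
Proof.
  intros Hn. assert (Hp : INR n <> 0) by now apply not_0_INR.
  rewrite (period_int_derive (fun t => sin (INR n * t) / INR n)).
  - replace (INR n * - PI) with (- (INR n * PI)) by ring.
    rewrite sin_neg, sin_INR_PI. unfold Rdiv; ring.
  - intros; auto_derive; [easy | field; easy].
  - apply continuous_cos_lin.
Qed.

(** The numerators of the Dirichlet kernel. They are themselves orthogonal over the period, so
    Bessel's inequality for them directly gives the form of the Riemann-Lebesgue lemma used for
    convergence. *)
Definition half_sin (n : nat) (t : R) : R := sin ((INR n + / 2) * t).

Lemma half_sin_product (n m : nat) (t : R) : (m <= n)%nat ->
  half_sin n t * half_sin m t
    = / 2 * cos (INR (n - m) * t) + - / 2 * cos (INR (n + m + 1) * t).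
Proof.
  intros H. unfold half_sin.
  rewrite minus_INR, !plus_INR by easy. simpl (INR 1).
  replace ((INR n - INR m) * t) with ((INR n + / 2) * t - (INR m + / 2) * t) by field.
  replace ((INR n + INR m + 1) * t) with ((INR n + / 2) * t + (INR m + / 2) * t) by field.
  rewrite cos_minus, cos_plus. field.
Qed.

Lemma half_sin_orthogonal (n m : nat) : (m < n)%nat ->
  period_int (fun t => half_sin n t * half_sin m t) = 0.
Proof.
  intros H.
  rewrite (period_int_ext _ _ (fun x _ => half_sin_product n m x (Nat.lt_le_incl _ _ H))).
  rewrite period_int_plus, !period_int_scal, !period_int_cos by
    (try apply continuous_period_scal; try apply continuous_cos_lin; lia).
  ring.
Qed.

Lemma half_sin_norm (n : nat) : period_int (fun t => half_sin n t * half_sin n t) = PI.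
Proof.
  rewrite (period_int_ext _ _ (fun x _ => half_sin_product n n x (le_n n))).
  rewrite period_int_plus, !period_int_scal, (period_int_cos (n + n + 1)) by
    (try apply continuous_period_scal; try apply continuous_cos_lin; lia).
  rewrite Nat.sub_diag. simpl INR.
  rewrite (period_int_ext _ (fun _ => 1)) by (intros; now rewrite Rmult_0_l, cos_0).
  rewrite period_int_const; field.
Qed.

(* [h] is [g] minus its projections on the first [M] functions [half_sin]; the sum is
   shifted by one so that it has [M] terms. *)
Lemma bessel_step (g : R -> R) (M : nat) : continuous_period g ->
  exists h, continuous_period h /\
    (forall n, (M <= n)%nat -> period_int (fun t => h t * half_sin n t)
                               = period_int (fun t => g t * half_sin n t)) /\
    period_int (fun t => h t * h t) =
      period_int (fun t => g t * g t)
      - / PI * sum_f_R0 (fun n => match n with O => 0 | S n =>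
                   period_int (fun t => g t * half_sin n t) ^ 2 end) M.
Proof.
  intros Cg. assert (P := PI_RGT_0).
  assert (Ch : forall n, continuous_period (half_sin n)) by (intros; apply continuous_sin_lin).
  induction M as [| M [h [H1 [H2 H3]]]].
  - exists g; split; [easy | split; [easy |]]. simpl; ring.
  - set (c := period_int (fun t => g t * half_sin M t)) in *.
    exists (fun t => h t + (- c / PI) * half_sin M t). split; [| split].
    + apply continuous_period_plus; [easy | now apply continuous_period_scal].
    + intros n Hn.
      rewrite (period_int_ext _ (fun t => h t * half_sin n t + (- c / PI) * (half_sin n t * half_sin M t)))
        by (intros; ring).
      rewrite period_int_plus, period_int_scal, half_sin_orthogonal, H2
        by (try apply continuous_period_scal; try apply continuous_period_mult; auto; lia).
      ring.
    + rewrite (period_int_ext _ (fun t => h t * h t + ((-2 * c / PI) * (h t * half_sin M t)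
                 + (c / PI) ^ 2 * (half_sin M t * half_sin M t)))) by (intros; field; lra).
      assert (C0 := continuous_period_mult _ _ H1 H1).
      assert (C1 := continuous_period_mult _ _ H1 (Ch M)).
      assert (C2 := continuous_period_mult _ _ (Ch M) (Ch M)).
      assert (C1' := continuous_period_scal (-2 * c / PI) _ C1).
      assert (C2' := continuous_period_scal ((c / PI) ^ 2) _ C2).
      rewrite (period_int_plus _ _ C0 (continuous_period_plus _ _ C1' C2')),
        (period_int_plus _ _ C1' C2'), (period_int_scal _ _ C1), (period_int_scal _ _ C2),
        half_sin_norm, H3, H2 by lia.
      rewrite tech5. cbv beta iota. fold c. field; lra.
Qed.

(** Bessel's inequality bounds the partial sums of the squared coefficients, so these are summable
    and tend to 0. The series [d] starts with the same extra 0 as in [bessel_step], and the limit is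
    read off after an index shift. *)
Lemma riemann_lebesgue_half (g : R -> R) : continuous_period g ->
  is_lim_seq (fun n => period_int (fun t => g t * half_sin n t)) 0.
Proof.
  intros Cg. assert (P := PI_RGT_0).
  set (c := fun n => period_int (fun t => g t * half_sin n t)).
  set (d := fun n => match n with O => 0 | S n => c n ^ 2 end).
  assert (B : forall M, sum_n d M <= PI * period_int (fun t => g t * g t)).
  { intros M. rewrite sum_n_Reals.
    destruct (bessel_step g M Cg) as [h [Ch [_ Eh]]].
    assert (0 <= period_int (fun t => h t * h t)).
    { apply period_int_ge_0; [now apply continuous_period_mult | intros; apply Rle_0_sqr]. }
    change (period_int (fun t => h t * h t) = period_int (fun t => g t * g t)
      - / PI * sum_f_R0 d M) in Eh.
    assert (/ PI * sum_f_R0 d M <= period_int (fun t => g t * g t)) by lra.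
    apply (Rmult_le_reg_l (/ PI)); [now apply Rinv_0_lt_compat |].
    rewrite <- Rmult_assoc, Rinv_l, Rmult_1_l by lra. easy. }
  assert (E : ex_series d).
  { apply ex_finite_lim_seq_incr with (2 := B). intros n. rewrite sum_Sn.
    change (sum_n d n <= sum_n d n + d (S n)). simpl. generalize (pow2_ge_0 (c n)); lra. }
  apply ex_series_lim_0, is_lim_seq_incr_1 in E. simpl in E.
  apply is_lim_seq_abs_0.
  apply is_lim_seq_ext with (fun n => sqrt (c n ^ 2)).
  - intros n. replace (c n ^ 2) with (Rsqr (c n)) by (unfold Rsqr; ring). apply sqrt_Rsqr_abs.
  - rewrite <- sqrt_0. apply is_lim_seq_continuous; [| exact E].
    apply continuity_pt_filterlim, continuous_sqrt.
Qed.

(** * Pointwise convergence of Fourier series *)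

Definition dirichlet_kernel (N : nat) (t : R) : R :=
  sum_f_R0 (fun n => match n with O => / 2 | S _ => cos (INR n * t) end) N.

(** Telescoping: 2 sin (t/2) cos (nt) = sin ((n + 1/2) t) - sin ((n - 1/2) t). *)
Lemma dirichlet_kernel_eq (N : nat) (t : R) :
  2 * sin (t / 2) * dirichlet_kernel N t = half_sin N t.
Proof.
  unfold dirichlet_kernel, half_sin; induction N as [| N IH].
  - simpl. replace ((0 + / 2) * t) with (t / 2) by field. field.
  - rewrite tech5, Rmult_plus_distr_l, IH.
    rewrite S_INR.
    replace ((INR N + / 2) * t) with ((INR N + 1) * t - t / 2) by field.
    replace ((INR N + 1 + / 2) * t) with ((INR N + 1) * t + t / 2) by field.
    rewrite sin_minus, sin_plus; ring.
Qed.

Lemma continuous_dirichlet_kernel (N : nat) : continuous_period (dirichlet_kernel N).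
Proof.
  induction N as [| N IH].
  - intros x _. apply continuous_const.
  - apply continuous_period_plus; [exact IH | apply continuous_cos_lin].
Qed.

Lemma period_int_dirichlet (N : nat) : period_int (dirichlet_kernel N) = PI.
Proof.
  induction N as [| N IH].
  - transitivity (period_int (fun _ => / 2)); [reflexivity |]. rewrite period_int_const; field.
  - transitivity (period_int (fun t => dirichlet_kernel N t + cos (INR (S N) * t))); [reflexivity |].
    rewrite period_int_plus, IH, period_int_cos
      by (try apply continuous_cos_lin; try apply continuous_dirichlet_kernel; lia).
    ring.
Qed.

Definition slope_at_0 (f : R -> R) (l t : R) : R :=
  if Req_EM_T t 0 then l else (f t - f 0) / t.

Lemma continuous_slope (f : R -> R) (l t : R) :
  is_derive f 0 l -> continuous f t -> continuous (slope_at_0 f l) t.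
Proof.
  intros D C. destruct (Req_dec t 0) as [-> | Ht].
  - apply continuity_pt_filterlim, continuity_pt_locally. intros eps.
    apply is_derive_Reals in D. destruct (D eps (cond_pos eps)) as [del Hdel].
    exists del; intros h Hh.
    unfold ball in Hh; simpl in Hh; unfold AbsRing_ball, abs, minus, plus, opp in Hh; simpl in Hh.
    rewrite Ropp_0, Rplus_0_r in Hh.
    unfold slope_at_0. destruct (Req_EM_T 0 0) as [_ |]; [| easy].
    destruct (Req_EM_T h 0) as [_ | Hn].
    + rewrite Rminus_diag, Rabs_R0. apply cond_pos.
    + specialize (Hdel h Hn Hh). now rewrite Rplus_0_l in Hdel.
  - apply continuous_ext_loc with (fun t => (f t - f 0) * / t).
    + assert (Hp : 0 < Rabs t) by now apply Rabs_pos_lt.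
      exists (mkposreal _ Hp); intros u Hu.
      unfold ball in Hu; simpl in Hu; unfold AbsRing_ball, abs, minus, plus, opp in Hu; simpl in Hu.
      unfold slope_at_0. destruct (Req_EM_T u 0) as [-> | _]; [| easy].
      exfalso; rewrite Rplus_0_l, Rabs_Ropp in Hu; lra.
    + apply (continuous_mult (fun t => f t - f 0) Rinv).
      * apply (continuous_minus f (fun _ => f 0)); [easy | apply continuous_const].
      * now apply continuous_Rinv.
Qed.

Definition smooth_periodic (v : R -> R) : Prop :=
  (forall s, v (s + 2 * PI) = v s) /\ (forall n s, ex_derive_n v n s).

Lemma smooth_periodic_derive (v : R -> R) :
  smooth_periodic v -> smooth_periodic (Derive v) /\ forall s, is_derive v s (Derive v s).
Proof.
  intros [Hp Hs]; assert (D : forall s, is_derive v s (Derive v s))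
    by (intros s; apply Derive_correct, (Hs 1%nat s)).
  split; [split | easy].
  - intros s. rewrite <- (Derive_ext (fun s => v (s + 2 * PI)) v s Hp).
    symmetry; apply is_derive_unique.
    generalize (is_derive_comp v (fun s => s + 2 * PI) s _ 1 (D _)).
    unfold scal; simpl; unfold mult; simpl. rewrite Rmult_1_l. intros K; apply K.
    auto_derive; [easy | ring].
  - intros n s. destruct n as [| n]; [exact I |].
    generalize (Hs (S (S n)) s). simpl. apply ex_derive_ext. intros t.
    change (Derive_n v (S n) t = Derive_n (Derive_n v 1) n t).
    now rewrite Derive_n_comp, Nat.add_1_r.
Qed.

Lemma smooth_periodic_continuous (v : R -> R) : smooth_periodic v -> forall s, continuous v s.
Proof.
  intros H s; apply (ex_derive_continuous (V := R_NormedModule)).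
  eexists; now apply smooth_periodic_derive.
Qed.

Definition fourier_cos (v : R -> R) (n : nat) : R := / PI * period_int (fun t => v t * cos (INR n * t)).
Definition fourier_sin (v : R -> R) (n : nat) : R := / PI * period_int (fun t => v t * sin (INR n * t)).

(* Half the usual coefficient at [n = 0], so that the series has no special term. *)
Definition fourier_a (v : R -> R) (n : nat) : R :=
  match n with O => fourier_cos v 0 / 2 | S _ => fourier_cos v n end.

Lemma fourier_partial_sum (v : R -> R) (N : nat) :
  continuous_period v ->
  sum_f_R0 (fourier_a v) N = / PI * period_int (fun t => v t * dirichlet_kernel N t).
Proof.
  intros Cv. induction N as [| N IH].
  - simpl sum_f_R0. unfold fourier_a, fourier_cos.
    rewrite (period_int_ext (fun t => v t * dirichlet_kernel 0 t)
               (fun t => / 2 * (v t * cos (INR 0 * t)))).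
    + rewrite period_int_scal; [unfold Rdiv; ring |].
      apply continuous_period_mult; [easy | apply continuous_cos_lin].
    + intros t _. simpl INR. rewrite Rmult_0_l, cos_0. unfold dirichlet_kernel; simpl; ring.
  - rewrite tech5, IH.
    rewrite (period_int_ext (fun t => v t * dirichlet_kernel (S N) t)
               (fun t => v t * dirichlet_kernel N t + v t * cos (INR (S N) * t))).
    + rewrite period_int_plus; [unfold fourier_a, fourier_cos; ring | |];
        (apply continuous_period_mult; [easy |]).
      * apply continuous_dirichlet_kernel.
      * apply continuous_cos_lin.
    + intros t _. unfold dirichlet_kernel. rewrite tech5. ring.
Qed.

(** At 0 the sine terms vanish, so the terms of the series are just [fourier_a]; the other points
    are reached by translation in [fourier_inversion]. *)
Lemma fourier_converges_at_0 (v : R -> R) :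
  smooth_periodic v -> is_series (fourier_a v) (v 0).
Proof.
  intros Hv. assert (P := PI_RGT_0). destruct (smooth_periodic_derive v Hv) as [_ Dv].
  assert (Cv : continuous_period v) by (intros x _; now apply smooth_periodic_continuous).
  set (w := fun t => 2 * sin (t / 2)).
  assert (Dw : forall t, is_derive w t (cos (t / 2)))
    by (intros; unfold w; auto_derive; [easy | unfold Rdiv; field]).
  assert (W0 : w 0 = 0) by (unfold w, Rdiv; rewrite Rmult_0_l, sin_0; ring).
  assert (Wn : forall t, - PI <= t <= PI -> t <> 0 -> w t <> 0).
  { intros t Ht Hn. unfold w. apply Rmult_integral_contrapositive; split; [lra |].
    destruct (Rdichotomy _ _ Hn).
    - apply Rlt_not_eq. replace (t / 2) with (- (- t / 2)) by field. rewrite sin_neg.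
      assert (0 < sin (- t / 2)) by (apply sin_gt_0; lra). lra.
    - apply Rgt_not_eq, sin_gt_0; lra. }
  (* Both [v - v 0] and [w] vanish at 0. Dividing each by [t] leaves two continuous functions, the
     second without zeros on the period. *)
  set (q := slope_at_0 w 1).
  assert (Qn : forall t, - PI <= t <= PI -> q t <> 0).
  { intros t Ht. unfold q, slope_at_0. destruct (Req_EM_T t 0) as [_ | Hn]; [lra |].
    rewrite W0, Rminus_0_r. apply Rmult_integral_contrapositive; split;
      [now apply Wn | now apply Rinv_neq_0_compat]. }
  (* [v - v 0 = g w] with [g] continuous, and [w] cancels the denominator of the Dirichlet
     kernel, so the error of the partial sums tends to 0 by the Riemann-Lebesgue lemma. *)
  set (g := fun t => slope_at_0 v (Derive v 0) t * / q t).
  assert (Cg : continuous_period g).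
  { intros t Ht. apply (continuous_mult (slope_at_0 v (Derive v 0)) (fun t => / q t)).
    - apply continuous_slope; [apply Dv | now apply smooth_periodic_continuous].
    - apply (continuous_comp q Rinv); [| now apply continuous_Rinv, Qn].
      apply continuous_slope.
      + generalize (Dw 0). unfold Rdiv; now rewrite Rmult_0_l, cos_0.
      + apply (ex_derive_continuous (V := R_NormedModule)). eexists; apply Dw. }
  assert (Gw : forall t, - PI <= t <= PI -> v t - v 0 = g t * w t).
  { intros t Ht. unfold g, q, slope_at_0. destruct (Req_EM_T t 0) as [-> | Hn].
    - rewrite W0; ring.
    - rewrite W0. generalize (Wn t Ht Hn); intros. field. split; lra. }
  assert (E : forall N, sum_n (fourier_a v) N
     = v 0 + / PI * period_int (fun t => g t * half_sin N t)).
  { intros N. rewrite sum_n_Reals, fourier_partial_sum by easy.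
    rewrite (period_int_ext (fun t => v t * dirichlet_kernel N t)
      (fun t => v 0 * dirichlet_kernel N t + g t * half_sin N t)).
    - assert (CD := continuous_dirichlet_kernel N).
      assert (CG : continuous_period (fun t => g t * half_sin N t))
        by (apply continuous_period_mult; [easy | apply continuous_sin_lin]).
      rewrite (period_int_plus _ _ (continuous_period_scal (v 0) _ CD) CG),
        (period_int_scal _ _ CD), period_int_dirichlet.
      as_Req. field; lra.
    - intros t Ht. rewrite <- dirichlet_kernel_eq.
      replace (v t) with (v 0 + g t * w t) by (rewrite <- Gw by easy; ring).
      unfold w; ring. }
  change (is_lim_seq (sum_n (fourier_a v)) (Finite (v 0))).
  apply (is_lim_seq_ext (fun N => v 0 + / PI * period_int (fun t => g t * half_sin N t))).
  - intros; symmetry; apply E.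
  - replace (Finite (v 0)) with (Finite (v 0 + / PI * 0)) by (f_equal; ring).
    apply is_lim_seq_plus'; [apply is_lim_seq_const |].
    apply (is_lim_seq_scal_l _ (/ PI) 0). now apply riemann_lebesgue_half.
Qed.

Lemma period_int_shift (h : R -> R) (s : R) :
  (forall t, h (t + 2 * PI) = h t) -> (forall t, continuous h t) ->
  period_int (fun t => h (t + s)) = period_int h.
Proof.
  intros Hp Hc.
  assert (Ex : forall a b, ex_RInt h a b)
    by (intros; now apply (ex_RInt_continuous (V := R_CompleteNormedModule))).
  assert (Sh : forall c a b, RInt (fun t => h (t + c)) a b = RInt h (a + c) (b + c)).
  { intros c a b. generalize (RInt_comp_lin h 1 c a b (Ex _ _)).
    rewrite !Rmult_1_l. intros <-. apply RInt_ext. intros t _.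
    change (h (t + c) = 1 * h (1 * t + c)). now rewrite !Rmult_1_l. }
  unfold period_int. rewrite Sh.
  assert (E : RInt h (- PI) (- PI + s) = RInt h PI (PI + s)).
  { rewrite (RInt_ext h (fun t => h (t + 2 * PI))) by (intros; symmetry; apply Hp).
    rewrite Sh. f_equal; ring. }
  assert (C1 := RInt_Chasles h (- PI) (- PI + s) (PI + s) (Ex _ _) (Ex _ _)).
  assert (C2 := RInt_Chasles h (- PI) PI (PI + s) (Ex _ _) (Ex _ _)).
  unfold plus in C1, C2; simpl in C1, C2. lra.
Qed.

Lemma trig_periodic (n : nat) (t : R) :
  cos (INR n * (t + 2 * PI)) = cos (INR n * t) /\ sin (INR n * (t + 2 * PI)) = sin (INR n * t).
Proof.
  replace (INR n * (t + 2 * PI)) with (INR n * t + 2 * INR n * PI) by ring.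
  now rewrite cos_period, sin_period.
Qed.

Lemma fourier_cos_translate (u : R -> R) (s : R) (n : nat) :
  smooth_periodic u ->
  fourier_cos (fun t => u (t + s)) n
    = fourier_cos u n * cos (INR n * s) + fourier_sin u n * sin (INR n * s).
Proof.
  intros Hu. assert (Cu := smooth_periodic_continuous u Hu). unfold fourier_cos, fourier_sin.
  set (h := fun t => cos (INR n * s) * (u t * cos (INR n * t)) + sin (INR n * s) * (u t * sin (INR n * t))).
  assert (Cc : forall t, continuous (fun t => u t * cos (INR n * t)) t).
  { intros t. apply (continuous_mult u); [easy |].
    apply (ex_derive_continuous (V := R_NormedModule)). auto_derive; easy. }
  assert (Cs : forall t, continuous (fun t => u t * sin (INR n * t)) t).
  { intros t. apply (continuous_mult u); [easy |].
    apply (ex_derive_continuous (V := R_NormedModule)). auto_derive; easy. }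
  rewrite (period_int_ext _ (fun t => h (t + s))).
  - rewrite period_int_shift.
    + unfold h. rewrite period_int_plus, !period_int_scal; [ring | | | |];
        try apply continuous_period_scal; intros x _; easy.
    + intros t; unfold h. destruct (trig_periodic n t) as [-> ->]. now rewrite (proj1 Hu).
    + intros t. apply (continuous_plus (fun t => cos (INR n * s) * (u t * cos (INR n * t)))
        (fun t => sin (INR n * s) * (u t * sin (INR n * t)))).
      * apply (continuous_scal_r (cos (INR n * s)) (fun t => u t * cos (INR n * t))), Cc.
      * apply (continuous_scal_r (sin (INR n * s)) (fun t => u t * sin (INR n * t))), Cs.
  - intros t _; unfold h.
    replace (INR n * t) with (INR n * (t + s) - INR n * s) by ring.
    rewrite cos_minus. ring.
Qed.

(** The [n]-th cosine coefficient of the translate of [u] by [s] is the [n]-th term of the series of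
    [u] at [s], so convergence at 0 for the translate is the claim. *)
Lemma fourier_inversion (u : R -> R) (s : R) :
  smooth_periodic u ->
  is_series (fun n => fourier_a u n * cos (INR n * s) + fourier_sin u n * sin (INR n * s)) (u s).
Proof.
  intros Hu.
  assert (Hv : smooth_periodic (fun t => u (t + s))).
  { split.
    - intros t. replace (t + 2 * PI + s) with (t + s + 2 * PI) by ring. apply Hu.
    - intros n t. destruct n as [| n]; [exact I |].
      apply ex_derive_ext with (fun t => Derive_n u n (t + s)).
      + intros x; symmetry; apply Derive_n_comp_trans.
      + apply (ex_derive_comp (Derive_n u n) (fun t => t + s)); [apply (proj2 Hu (S n)) |].
        auto_derive; easy. }
  generalize (fourier_converges_at_0 _ Hv). rewrite Rplus_0_l.
  apply is_series_ext; intros n.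
  destruct n as [| n].
  - unfold fourier_a. rewrite fourier_cos_translate by easy.
    simpl INR. rewrite Rmult_0_l, cos_0, sin_0.
    as_Req. field.
  - apply fourier_cos_translate, Hu.
Qed.

(** * Decay of the Fourier coefficients *)

Lemma fourier_by_parts (v : R -> R) (n : nat) :
  smooth_periodic v ->
  INR n * fourier_cos v n = - fourier_sin (Derive v) n /\
  INR n * fourier_sin v n = fourier_cos (Derive v) n.
Proof.
  intros Hv. destruct (smooth_periodic_derive v Hv) as [Hd Dv].
  assert (C : continuous_period v) by (intros x _; now apply smooth_periodic_continuous).
  assert (C' : continuous_period (Derive v)) by (intros x _; now apply smooth_periodic_continuous).
  assert (Cc := continuous_cos_lin (INR n)). assert (Cs := continuous_sin_lin (INR n)).
  assert (Per : forall f : R -> R, (forall t, f (t + 2 * PI) = f t) -> f PI - f (- PI) = 0).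
  { intros f Hf. rewrite <- (Hf (- PI)). replace (- PI + 2 * PI) with PI by ring. ring. }
  assert (K1 : period_int (fun t => Derive v t * sin (INR n * t) + INR n * (v t * cos (INR n * t))) = 0).
  { rewrite (period_int_derive (fun t => v t * sin (INR n * t))).
    - apply (Per (fun t => v t * sin (INR n * t))). intros t.
      now rewrite (proj2 (trig_periodic n t)), (proj1 Hv).
    - intros t.
      generalize (is_derive_mult v (fun t => sin (INR n * t)) t (Derive v t) (INR n * cos (INR n * t))).
      unfold plus, mult; simpl.
      replace (INR n * (v t * cos (INR n * t))) with (v t * (INR n * cos (INR n * t))) by ring.
      intros K; apply K; [apply Dv | auto_derive; [easy | ring] | exact Rmult_comm].
    - apply continuous_period_plus; [| apply continuous_period_scal]; now apply continuous_period_mult. }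
  assert (K2 : period_int (fun t => Derive v t * cos (INR n * t) + - INR n * (v t * sin (INR n * t))) = 0).
  { rewrite (period_int_derive (fun t => v t * cos (INR n * t))).
    - apply (Per (fun t => v t * cos (INR n * t))). intros t.
      now rewrite (proj1 (trig_periodic n t)), (proj1 Hv).
    - intros t.
      generalize (is_derive_mult v (fun t => cos (INR n * t)) t (Derive v t) (- INR n * sin (INR n * t))).
      unfold plus, mult; simpl.
      replace (- INR n * (v t * sin (INR n * t))) with (v t * (- INR n * sin (INR n * t))) by ring.
      intros K; apply K; [apply Dv | auto_derive; [easy | ring] | exact Rmult_comm].
    - apply continuous_period_plus; [| apply continuous_period_scal]; now apply continuous_period_mult. }
  rewrite period_int_plus, period_int_scal in K1, K2
    by (try apply continuous_period_scal; now apply continuous_period_mult).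
  unfold fourier_cos, fourier_sin. split.
  - transitivity (/ PI * (INR n * period_int (fun t => v t * cos (INR n * t)))); [ring |].
    replace (INR n * period_int (fun t => v t * cos (INR n * t)))
      with (- period_int (fun t => Derive v t * sin (INR n * t))) by lra. ring.
  - transitivity (/ PI * (INR n * period_int (fun t => v t * sin (INR n * t)))); [ring |].
    f_equal. lra.
Qed.

Lemma fourier_bounded (v : R -> R) : smooth_periodic v ->
  exists C, forall n, Rabs (fourier_cos v n) <= C /\ Rabs (fourier_sin v n) <= C.
Proof.
  intros Hv. assert (P := PI_RGT_0).
  assert (Cv := smooth_periodic_continuous v Hv).
  destruct (continuity_ab_maj (fun t => Rabs (v t)) (- PI) PI) as [m [Hm _]]; [lra | |].
  { intros t _. apply continuity_pt_filterlim.
    apply (continuous_comp v Rabs); [easy | apply continuous_Rabs]. }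
  exists (/ PI * ((PI - - PI) * Rabs (v m))).
  assert (B : forall w : R -> R, continuous_period w -> (forall t, Rabs (w t) <= 1) ->
    Rabs (/ PI * period_int (fun t => v t * w t)) <= / PI * ((PI - - PI) * Rabs (v m))).
  { intros w Cw Bw. assert (Hi : 0 < / PI) by now apply Rinv_0_lt_compat.
    rewrite Rabs_mult, (Rabs_right (/ PI)) by lra.
    apply Rmult_le_compat_l; [lra |].
    apply abs_RInt_le_const; [lra | apply ex_period_int, continuous_period_mult; [now intros x _ | easy] |].
    intros t Ht. rewrite Rabs_mult. specialize (Hm t Ht); simpl in Hm.
    generalize (Bw t) (Rabs_pos (w t)) (Rabs_pos (v t)); nra. }
  intros n; split; apply B.
  - apply continuous_cos_lin.
  - intros; apply Rabs_le, COS_bound.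
  - apply continuous_sin_lin.
  - intros; apply Rabs_le, SIN_bound.
Qed.

(** Each integration by parts trades a factor [n] for a derivative and exchanges sine and cosine
    coefficients, so the induction runs over all [v] and both kinds at once. *)
Lemma fourier_decay (p : nat) (v : R -> R) : smooth_periodic v ->
  exists C, forall n, Rabs (fourier_cos v n) * INR n ^ p <= C /\ Rabs (fourier_sin v n) * INR n ^ p <= C.
Proof.
  revert v; induction p as [| p IH]; intros v Hv.
  - destruct (fourier_bounded v Hv) as [C HC]; exists C; intros n; simpl; rewrite !Rmult_1_r; apply HC.
  - destruct (IH _ (proj1 (smooth_periodic_derive v Hv))) as [C HC].
    exists C; intros n. destruct (HC n) as [H1 H2]. destruct (fourier_by_parts v n Hv) as [E1 E2].
    assert (E : forall x, Rabs x * INR n ^ S p = Rabs (INR n * x) * INR n ^ p).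
    { intros x. rewrite Rabs_mult, (Rabs_right (INR n)) by (apply Rle_ge, pos_INR). simpl; ring. }
    rewrite !E, E1, E2, Rabs_Ropp. easy.
Qed.

Lemma rapid_of_decay (a : nat -> R) :
  (forall p, exists C, forall n, Rabs (a n) * INR n ^ p <= C) -> rapid a.
Proof.
  intros H p. destruct (H p) as [C HC].
  (* For n >= 1, n + 1 <= 2n costs the factor 2^p; the first summand covers [n = 0]. *)
  exists (Rabs (a O) + 2 ^ p * Rabs C); intros n.
  assert (P2 : 0 < 2 ^ p) by (apply pow_lt; lra).
  assert (AC := Rabs_pos C).
  destruct n as [| n].
  - simpl INR. rewrite Rplus_0_l, pow1. nra.
  - assert (B : (INR (S n) + 1) ^ p <= 2 ^ p * INR (S n) ^ p).
    { rewrite <- Rpow_mult_distr. apply pow_incr. rewrite S_INR. generalize (pos_INR n); lra. }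
    specialize (HC (S n)). generalize (Rabs_pos (a (S n))) (Rabs_pos (a O)) (Rle_abs C); intros.
    assert (Rabs (a (S n)) * (INR (S n) + 1) ^ p <= 2 ^ p * (Rabs (a (S n)) * INR (S n) ^ p)).
    { replace (2 ^ p * (Rabs (a (S n)) * INR (S n) ^ p)) with (Rabs (a (S n)) * (2 ^ p * INR (S n) ^ p)) by ring.
      now apply Rmult_le_compat_l. }
    assert (2 ^ p * (Rabs (a (S n)) * INR (S n) ^ p) <= 2 ^ p * Rabs C)
      by (apply Rmult_le_compat_l; lra).
    lra.
Qed.

Lemma rapid_fourier_a (v : R -> R) : smooth_periodic v -> rapid (fourier_a v).
Proof.
  intros Hv; apply rapid_of_decay; intros p. destruct (fourier_decay p v Hv) as [C HC].
  exists (Rabs (fourier_a v 0) * INR 0 ^ p + Rabs C); intros n.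
  destruct n as [| n].
  - generalize (Rabs_pos C); lra.
  - generalize (proj1 (HC (S n))) (Rle_abs C); intros.
    change (fourier_a v (S n)) with (fourier_cos v (S n)).
    assert (0 <= Rabs (fourier_a v 0) * INR 0 ^ p)
      by (apply Rmult_le_pos; [apply Rabs_pos | apply pow_le, pos_INR]).
    lra.
Qed.

Lemma rapid_fourier_sin (v : R -> R) : smooth_periodic v -> rapid (fourier_sin v).
Proof.
  intros Hv; apply rapid_of_decay; intros p. destruct (fourier_decay p v Hv) as [C HC].
  exists C; intros n; apply HC.
Qed.

(** * The Dirichlet-to-Neumann operator *)

Lemma circle_fun_smooth_periodic (u : circle_fun) : smooth_periodic u.
Proof. split; [apply cfun_periodic | apply cfun_smooth]. Qed.

Lemma circle_fun_eq (u v : circle_fun) : (forall s, u s = v s) -> u = v.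
Proof.
  destruct u as [u pu su], v as [v pv sv]; simpl; intros E.
  apply functional_extensionality in E; subst v.
  f_equal; apply proof_irrelevance.
Qed.

(** The square root of minus the second derivative on the circle. Neither [k] nor the quotient
    enters. *)
Definition frequency_multiplier (u : circle_fun) : circle_fun :=
  let a n := INR n * fourier_a u n in
  let b n := INR n * fourier_sin u n in
  CircleFun (trig_sum a b) (trig_sum_periodic a b)
    (fun n s => trig_sum_smooth a b n s
       (rapid_scale _ (rapid_fourier_a u (circle_fun_smooth_periodic u)))
       (rapid_scale _ (rapid_fourier_sin u (circle_fun_smooth_periodic u)))).

(* Satisfied by both the disk (with [k = 1]) and the cone. *)
Record rotation_quotient (k : nat) (O : disk_quotient) : Prop := {
  rq_pos : (1 <= k)%nat;
  rq_radius : radius (circ O) = INR k;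
  rq_surj : forall p, exists z, proj O z = p;
  rq_descent : forall F : R * R -> R,
    (forall j p, F (rot (IZR j * (2 * PI / INR k)) p) = F p) ->
    exists w : point O -> R, forall z, w (proj O z) = F (proj1_sig z)
}.

Lemma rq_radius_pos (k : nat) (O : disk_quotient) :
  rotation_quotient k O -> 0 < radius (circ O).
Proof. intros H; rewrite (rq_radius k O H); apply lt_0_INR. generalize (rq_pos k O H); lia. Qed.

Lemma extension_descends (k : nat) (O : disk_quotient) (u : circle_fun) :
  rotation_quotient k O ->
  exists w, harmonic_extension O u w /\
    smooth_lift O w (extension k (fourier_a u) (fourier_sin u)).
Proof.
  intros H. assert (Hk := rq_pos k O H).
  assert (Hu := circle_fun_smooth_periodic u).
  assert (Ra := rapid_fourier_a u Hu). assert (Rb := rapid_fourier_sin u Hu).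
  set (F := extension k (fourier_a u) (fourier_sin u)).
  destruct (rq_descent k O H (fun p => F (fst p) (snd p))) as [w Hw].
  { intros j p. now apply extension_rot. }
  assert (L : smooth_lift O w F) by (split; [now apply extension_smooth2 | apply Hw]).
  exists w; split; [split | exact L].
  - exists F; split; [exact L |]. intros x y. rewrite (rq_radius k O H).
    now apply extension_harmonic.
  - intros s. rewrite Hw. simpl. rewrite (rq_radius k O H).
    unfold F. rewrite extension_boundary by easy.
    apply is_series_unique, fourier_inversion, Hu.
Qed.

(** As [proj] is onto, it suffices to compare lifts on the disk, where the maximum principle
    applies. On the boundary, the angle [t] corresponds to the arclength [r * t]. *)
Lemma harmonic_extension_unique (k : nat) (O : disk_quotient) (u : circle_fun) (w w' : point O -> R) :
  rotation_quotient k O ->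
  harmonic_extension O u w -> harmonic_extension O u w' -> w = w'.
Proof.
  intros H [[F [[SF LF] HF]] BF] [[G [[SG LG] HG]] BG].
  extensionality p. destruct (rq_surj k O H p) as [z <-].
  rewrite LF, LG. assert (Hr := rq_radius_pos k O H).
  apply (harmonic_uniqueness F G (radius (circ O))); try easy; [| exact (proj2_sig z)].
  intros x y Hxy. destruct (circle_polar x y _ Hr Hxy) as [t [-> ->]].
  set (r := radius (circ O)) in *.
  generalize (LF (boundary_pt (circ O) (r * t))) (LG (boundary_pt (circ O) (r * t))).
  rewrite BF, BG. simpl. fold r. replace (r * t / r) with t by (field; lra). congruence.
Qed.

Lemma normal_derivative_unique (k : nat) (O : disk_quotient) (w : point O -> R) (s d d' : R) :
  rotation_quotient k O ->
  is_normal_derivative O w s d -> is_normal_derivative O w s d' -> d = d'.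
Proof.
  intros H [F [[_ LF] DF]] [G [[_ LG] DG]].
  assert (Hr := rq_radius_pos k O H). set (r := radius (circ O)) in *.
  set (f := fun t => F ((r + t) * cos (s / r)) ((r + t) * sin (s / r))) in *.
  set (g := fun t => G ((r + t) * cos (s / r)) ((r + t) * sin (s / r))) in *.
  (* Two lifts need only agree on the closed disk, that is for [t <= 0]; left difference
     quotients suffice. *)
  assert (E : forall t, - r <= t <= 0 -> f t = g t).
  { intros t Ht.
    assert (B : ((r + t) * cos (s / r)) ^ 2 + ((r + t) * sin (s / r)) ^ 2 <= radius (circ O) ^ 2).
    { fold r. generalize (sin2_cos2 (s / r)); unfold Rsqr; intros T.
      replace (((r + t) * cos (s / r)) ^ 2 + ((r + t) * sin (s / r)) ^ 2) with ((r + t) ^ 2)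
        by (transitivity ((r + t) ^ 2 * (sin (s / r) * sin (s / r) + cos (s / r) * cos (s / r)));
            [rewrite T; ring | ring]).
      apply pow_incr; lra. }
    generalize (LF (exist _ (_, _) B)) (LG (exist _ (_, _) B)). unfold f, g; simpl. congruence. }
  assert (D : is_derive (fun t => f t - g t) 0 (d - d'))
    by now apply (is_derive_minus f g 0 d d').
  apply is_derive_Reals in D.
  destruct (Req_dec d d') as [| Hn]; [easy | exfalso].
  (* The tolerance is |d - d'| itself: the difference quotient of [f - g] at [- h] is 0, so the
     estimate reads |d - d'| < |d - d'|. *)
  assert (He : 0 < Rabs (d - d')) by (apply Rabs_pos_lt; lra).
  destruct (D _ He) as [del Hdel]. assert (Hp := cond_pos del).
  set (h := Rmin (del / 2) r).
  assert (H0 : 0 < h) by (apply Rmin_pos; lra).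
  assert (H1 : h <= del / 2) by apply Rmin_l. assert (H2 : h <= r) by apply Rmin_r.
  specialize (Hdel (- h) ltac:(lra) ltac:(rewrite Rabs_Ropp, Rabs_right; lra)).
  rewrite Rplus_0_l, (E (- h)), (E 0) in Hdel by lra.
  replace ((g (- h) - g (- h) - (g 0 - g 0)) / - h - (d - d')) with (- (d - d')) in Hdel
    by (field; lra).
  rewrite Rabs_Ropp in Hdel. lra.
Qed.

Lemma DN_graph_iff (k : nat) (O : disk_quotient) (u g : circle_fun) :
  rotation_quotient k O -> DN_graph O u g <-> g = frequency_multiplier u.
Proof.
  intros H. assert (Hk := rq_pos k O H).
  assert (Hu := circle_fun_smooth_periodic u).
  assert (Ra := rapid_fourier_a u Hu). assert (Rb := rapid_fourier_sin u Hu).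
  destruct (extension_descends k O u H) as [w [Ew Lw]].
  assert (N : forall s, is_normal_derivative O w s (frequency_multiplier u s)).
  { intros s. exists (extension k (fourier_a u) (fourier_sin u)); split; [exact Lw |].
    rewrite (rq_radius k O H). now apply extension_normal_derivative. }
  split.
  - intros [w' [Ew' N']]. rewrite (harmonic_extension_unique k O u w' w H Ew' Ew) in N'.
    apply circle_fun_eq; intros s.
    exact (normal_derivative_unique k O w s _ _ H (N' s) (N s)).
  - intros ->. now exists w.
Qed.

(** The disk and the cone meet here: any two rotation quotients, whatever their [k], have the same
    operator. *)
Lemma rotation_quotient_DN (k : nat) (O : disk_quotient) :
  rotation_quotient k O -> DN_well_defined O /\ DN O = frequency_multiplier.
Proof.
  intros H; split.
  - intros u; split.
    + destruct (extension_descends k O u H) as [w [Ew _]]. exists w; split; [easy |].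
      intros w' Ew'. now apply (harmonic_extension_unique k O u).
    + exists (frequency_multiplier u); split; [now apply (DN_graph_iff k) |].
      intros g Hg. symmetry; now apply (DN_graph_iff k O).
  - extensionality u. apply (DN_graph_iff k O u _ H). unfold DN. apply epsilon_spec.
    exists (frequency_multiplier u). now apply (DN_graph_iff k).
Qed.

(** * The disk and the cone as rotation quotients *)

Lemma flat_disk_rotation_quotient : rotation_quotient 1 (flat_disk (2 * PI)).
Proof.
  assert (P := PI_RGT_0). constructor.
  - lia.
  - unfold radius; simpl; field; lra.
  - intros p; now exists p.
  - intros F _. now exists (fun z => F (proj1_sig z)).
Qed.

Lemma cone_rotation_quotient (k : nat) : (1 <= k)%nat -> rotation_quotient k (cone k).
Proof.
  assert (P := PI_RGT_0). intros Hk. assert (HK : 0 < INR k) by (apply lt_0_INR; lia).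
  constructor.
  - exact Hk.
  - unfold radius; simpl; field; lra.
  - intros [A [z Ez]]. exists z. subst A. reflexivity.
  - intros F HF.
    (* [F] is evaluated at a chosen representative of the orbit; its invariance makes the choice
       irrelevant. *)
    exists (fun A : orbit_space k (2 * PI * INR k) =>
       F (proj1_sig (proj1_sig (constructive_indefinite_description _ (proj2_sig A))))).
    intros z. simpl.
    destruct (constructive_indefinite_description _ _) as [z' Ez']; simpl.
    (* The orbits of [z] and of the representative [z'] are equal as predicates, so [z], being in
       its own orbit, is a rotation of [z']. *)
    assert (M : orbit k (2 * PI * INR k) z z).
    { exists 0%Z. unfold rot. rewrite Rmult_0_l, cos_0, sin_0.
      destruct z as [[x y] hz]; simpl; f_equal; ring. }
    simpl in Ez'. rewrite Ez' in M. destruct M as [j Ej].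
    apply (f_equal F) in Ej. rewrite HF in Ej. symmetry; exact Ej.
Qed.

Theorem theorem4p1 : forall k : nat, (1 <= k)%nat ->
  DN_well_defined (flat_disk (2 * PI)) /\
  DN_well_defined (cone k) /\
  DN (flat_disk (2 * PI)) = DN (cone k).
Proof.
  intros k Hk.
  destruct (rotation_quotient_DN 1 _ flat_disk_rotation_quotient) as [W1 E1].
  destruct (rotation_quotient_DN k _ (cone_rotation_quotient k Hk)) as [W2 E2].
  split; [exact W1 | split; [exact W2 | congruence]].
Qed.
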